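(* Assume that $\beta:\mathbb R\to\mathbb R$ is Lipschitz, and let $u_1,u_2$ be two solutions of the sliding drop problem (with the same $\beta$ and the same volume $V_0$), with supports $(a_1(t),b_1(t))$ and $(a_2(t),b_2(t))$ respectively, such that $$a_1(0)\le a_2(0)\quad\text{and}\quad b_1(0)\le b_2(0).$$ Then $$a_1(t)\le a_2(t)\quad\text{and}\quad b_1(t)\le b_2(t)\qquad\text{for all } t>0.$$ Furthermore, if both inequalities at time $0$ are strict, then both inequalities at every $t>0$ are strict.
   Context: Fix constants $V_0>0$ (volume), $\kappa>0$ and $0<\alpha<\pi/2$. Functions in $H^1_0(a,b)$ are extended by $0$ to $\mathbb R$. Set $$\mathcal F(v)=\int_{\mathbb R}\frac12|v_x|^2+\frac{v^2}{2}\kappa\cos\alpha-v\,x\,\kappa\sin\alpha\,dx .$$ Admissible initial datum: a function $u_0$ for which there are $a_0<b_0$ with $\{u_0>0\}=(a_0,b_0)$ and $u_0=\mathrm{argmin}\{\mathcal F(v): v\in H^1_0(a_0,b_0),\ v\ge 0,\ \int v\,dx=V_0\}$. Solution of the sliding drop problem with initial datum $u_0$: a function $u(x,t)$, $t\ge0$, for which there exist Lipschitz functions $a(t),b(t)$ on $[0,\infty)$ with $a(0)=a_0$, $b(0)=b_0$ such that, for all $t\ge 0$, $\{x: u(x,t)>0\}=(a(t),b(t))$ and $$u(\cdot,t)=\mathrm{argmin}\Big\{\mathcal F(v): v\in H^1_0(a(t),b(t)),\ v\ge0,\ \int_{a(t)}^{b(t)} v\,dx=V_0\Big\},$$ and,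 for a.e. $t\ge0$, $$\min\{a'(t)+\tfrac12|u_x(a(t),t)|^2-\beta(a(t)),\ |u_x(a(t),t)|\}=0,$$ $$\min\{-b'(t)+\tfrac12|u_x(b(t),t)|^2-\beta(b(t)),\ |u_x(b(t),t)|\}=0,$$ where $u_x(a(t),t)$, $u_x(b(t),t)$ are one-sided derivatives taken from inside $(a(t),b(t))$. *)

(* Defs.v *)
From HB Require Import structures.
From mathcomp Require Import all_boot all_order all_algebra.
From mathcomp Require Import all_classical all_reals all_analysis.

Set Implicit Arguments.
Unset Strict Implicit.
Unset Printing Implicit Defensive.
Import Order.TTheory GRing.Theory Num.Theory.
Import numFieldNormedType.Exports.
Local Open Scope classical_set_scope.
Local Open Scope ring_scope.

Definition C1c (R : realType) (U : set R) (phi : R -> R) : Prop :=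
  [/\ forall x, derivable phi x 1,
      continuous (derive1 phi),
      compact (closure [set x | phi x != 0])
    & closure [set x | phi x != 0] `<=` U].

Definition is_weak_deriv (R : realType) (v g : R -> R) : Prop :=
  g \in Lfun lebesgue_measure 2%:E /\
  forall phi : R -> R, C1c setT phi ->
    \int[lebesgue_measure]_x (v x * derive1 phi x) =
    - \int[lebesgue_measure]_x (g x * phi x).

(* Unique up to a null set when it exists, hence only ever used under an
   integral sign or in a norm. *)
Definition weak_deriv (R : realType) (v : R -> R) : R -> R :=
  xget (cst 0) [set g | is_weak_deriv v g].

Definition H1 (R : realType) (v : R -> R) : Prop :=
  v \in Lfun lebesgue_measure 2%:E /\ exists g, is_weak_deriv v g.

(* H^1_0(a, b), extended by 0 to the line: closure of C^1_c(a, b) for the H^1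
   norm. Each class is represented by its continuous representative, so that
   positivity sets and one-sided derivatives at a point make sense. *)
Definition H10 (R : realType) (a b : R) (v : R -> R) : Prop :=
  [/\ H1 v,
      continuous v,
      forall x, x \notin `]a, b[ -> v x = 0
    & forall e : R, 0 < e -> exists phi : R -> R,
        [/\ C1c `]a, b[%classic phi,
            ('N[lebesgue_measure]_2%:E[EFin \o (v \- phi)%R] < e%:E)%E
          & ('N[lebesgue_measure]_2%:E[EFin \o (weak_deriv v \- derive1 phi)%R]
              < e%:E)%E]].

Definition energy (R : realType) (kappa alpha : R) (v : R -> R) : R :=
  \int[lebesgue_measure]_x
    (2^-1 * `|weak_deriv v x| ^+ 2 + v x ^+ 2 / 2 * (kappa * cos alpha)
     - v x * x * (kappa * sin alpha)).

Definition admissible_profile (R : realType) (V0 a b : R) (v : R -> R) : Prop :=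
  [/\ H10 a b v, forall x, 0 <= v x
    & \int[lebesgue_measure]_(x in `]a, b[) v x = V0].

Definition is_argmin (R : realType) (V0 kappa alpha a b : R) (u : R -> R)
    : Prop :=
  admissible_profile V0 a b u /\
  forall v, admissible_profile V0 a b v ->
    energy kappa alpha u <= energy kappa alpha v.

Definition admissible_datum (R : realType) (V0 kappa alpha a0 b0 : R)
    (u0 : R -> R) : Prop :=
  [/\ a0 < b0, [set x | 0 < u0 x] = `]a0, b0[%classic
    & is_argmin V0 kappa alpha a0 b0 u0].

Definition is_right_deriv (R : realType) (f : R -> R) (x l : R) : Prop :=
  h^-1 * (f (x + h) - f x) @[h --> 0^'+] --> l.

Definition is_left_deriv (R : realType) (f : R -> R) (x l : R) : Prop :=
  h^-1 * (f (x + h) - f x) @[h --> 0^'-] --> l.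

(* Only the values at times t >= 0 of u, a and b are constrained. The support
   endpoints a and b are determined by u. *)
Record sliding_drop_solution (R : realType) (V0 kappa alpha : R)
    (beta : R -> R) (u0 : R -> R) (u : R -> R -> R) (a b : R -> R) : Prop := {
  sds_datum : exists a0 b0,
    [/\ admissible_datum V0 kappa alpha a0 b0 u0, a 0 = a0 & b 0 = b0];
  sds_lipschitz_a : [lipschitz a t | t in `[0, +oo[%classic];
  sds_lipschitz_b : [lipschitz b t | t in `[0, +oo[%classic];
  sds_support : forall t : R, 0 <= t -> [set x | 0 < u x t] = `]a t, b t[%classic;
  sds_argmin : forall t : R, 0 <= t ->
    is_argmin V0 kappa alpha (a t) (b t) (u^~ t);
  sds_speed_a : {ae lebesgue_measure, forall t, 0 <= t ->
    derivable a t 1 /\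
    exists2 p, is_right_deriv (u^~ t) (a t) p &
      Num.min (derive1 a t + 2^-1 * `|p| ^+ 2 - beta (a t)) `|p| = 0};
  sds_speed_b : {ae lebesgue_measure, forall t, 0 <= t ->
    derivable b t 1 /\
    exists2 q, is_left_deriv (u^~ t) (b t) q &
      Num.min (- derive1 b t + 2^-1 * `|q| ^+ 2 - beta (b t)) `|q| = 0} }.

(* Main.v *)
Require Import Defs.
From HB Require Import structures.
From mathcomp Require Import all_boot all_order all_algebra.
From mathcomp Require Import all_classical all_reals all_analysis.
From mathcomp Require Import measurable_realfun ring lra.

(** The comparison principle rests on two facts.

    A drop of given volume has contact slopes that depend only on the length
    of its support.  Put c = kappa cos alpha, s = kappa sin alpha.  A positive
    minimizer u on (a, b) solves the linear equation u'' = c u - s x - lam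
    with a Lagrange multiplier lam.  Testing it against the two exponentials
    exp (x sqrt c), exp (- x sqrt c) and against 1 yields three linear
    relations between p = u'(a), q = u'(b) and lam; eliminating lam,
      p + q = - 2 (s / c) G,   (p - q) G = c V0,
      G = y / 2 * coth (y / 2) - 1,   y = sqrt c * (b - a)
    ([ode_slopes]).  G increases with y, and p >= 0 because u >= 0.  Hence
    both p and |q| decrease when the drop gets longer ([drop_slopes_le]), and
    p vanishes only for the longest possible drop ([drop_slopes_max]).

    The endpoints therefore obey a cooperative system.  Consider
    M = max (a1 - a2, b1 - b2), and let K be a Lipschitz constant of beta.  If
    a1 - a2 realizes the maximum then drop 1 is the shorter one, so p1 >= p2
    and a1' - a2' <= beta a1 - beta a2 <= K |M|; if b1 - b2 realizes it then
    drop 1 is the longer one, |q1| <= |q2|, and b1' - b2' <= K |M|.  The law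
    of a1 is an equation only when p1 > 0.  When p1 = 0 and drop 1 is the
    shorter one, both drops have the maximal length; at such a time the
    derivative of each length vanishes, and the bound on a1' - a2' follows
    from the one on b1' - b2' ([endpoints_dini]).  As M is Lipschitz and this
    bound on its right Dini derivative holds at almost every time, Gronwall's
    lemma gives both the weak and the strict comparison ([gronwall_le0],
    [gronwall_lt0]).

    To reach the differential equation, a minimizer is perturbed by multiples
    of a C^1 function with compact support in (a, b) and zero mean.  The
    energy of the perturbed profile involves the weak derivative chosen for
    that profile, so almost everywhere uniqueness of weak derivatives is
    needed ([ae_eq0_C1c]).  The first variation is then tested on cubic
    splines: their second derivatives are combinations of hat functions,
    and shrinking the hats shows that u minus a double antiderivative of
    c u - s x - lam is affine ([du_bois_reymond], [argmin_ode]). *)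

Set Implicit Arguments.
Unset Strict Implicit.
Unset Printing Implicit Defensive.
Import Order.TTheory GRing.Theory Num.Theory.
Import numFieldNormedType.Exports.
Local Open Scope classical_set_scope.
Local Open Scope ring_scope.

(** * Functions with compact support *)

Section CompactSupport.
Context {R : realType}.
Notation mu := (@lebesgue_measure R).
Implicit Types (f g : R -> R) (A B x : R).

Lemma restrict_supp f A B : (forall x, x \notin `[A, B] -> f x = 0) ->
  f \_ `[A, B] = f.
Proof.
move=> f0; apply/funext => x; rewrite patchE; case: ifPn => // xAB.
by rewrite f0//; apply: contra xAB => xAB; rewrite inE.
Qed.

Lemma integrable_cc f A B : continuous f ->
  (forall x, x \notin `[A, B] -> f x = 0) -> mu.-integrable setT (EFin \o f).
Proof.
move=> cf f0; rewrite -(restrict_supp f0) -restrict_EFin.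
apply/integrable_restrict => //; rewrite setTI.
apply: continuous_compact_integrable; first exact: segment_compact.
exact: continuous_subspaceT.
Qed.

Lemma Rintegral_supp f A B : (forall x, x \notin `[A, B] -> f x = 0) ->
  \int[mu]_x f x = \int[mu]_(x in `[A, B]) f x.
Proof. by move=> f0; rewrite [RHS]Rintegral_mkcond restrict_supp. Qed.

Lemma Lfun2_cc f A B : continuous f ->
  (forall x, x \notin `[A, B] -> f x = 0) -> f \in Lfun mu 2%:E.
Proof.
move=> cf f0; rewrite inE; apply/andP; split; rewrite inE/=.
  exact: continuous_measurable_fun.
rewrite /finite_norm unlock poweR_lty//.
have -> : (\int[mu]_x `|(EFin \o f) x| `^ 2 =
           \int[mu]_x `|(f x * f x)%:E|)%E.
  apply: eq_integral => x _ /=.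
  by rewrite powR_mulrn// expr2 -normrM.
have /integrableP[_ //] : mu.-integrable setT (EFin \o (fun x => f x * f x)).
apply: (@integrable_cc _ A B) => [x|x xAB]; first by apply: continuousM; exact: cf.
by rewrite f0// mul0r.
Qed.

Lemma Lfun2_mul_integrable f g : f \in Lfun mu 2%:E -> g \in Lfun mu 2%:E ->
  mu.-integrable setT (EFin \o (fun x => f x * g x)).
Proof. by move=> lf lg; have /Lfun1_integrable := Lfun2_mul_Lfun1 lf lg. Qed.

(** The truncated power of spline theory.  It is continuously differentiable only
    from [n = 2] on, whence the shifts of the exponent below; for [n = 0] it is
    the constant 1. *)
Definition tpow (n : nat) (x : R) : R := Num.max 0 x ^+ n.

Lemma continuous_tpow n : continuous (tpow n).
Proof.
move=> x; have -> : tpow n = (fun y : R => y ^+ n) \o (fun y => Num.max 0 y) by [].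
apply: continuous_comp; last exact: exprn_continuous.
by apply: continuous_max; [exact: cst_continuous|exact: id].
Qed.

Lemma tpow_le0 n x : x <= 0 -> tpow n.+1 x = 0.
Proof. by move=> x0; rewrite /tpow max_l// expr0n. Qed.

Lemma tpow_ge0E n x : 0 <= x -> tpow n x = x ^+ n.
Proof. by move=> x0; rewrite /tpow max_r. Qed.

Lemma tpow_ge0 n x : 0 <= tpow n x.
Proof. by rewrite exprn_ge0// le_max lexx. Qed.


(** At 0 the difference quotient of [tpow n.+2] is [tpow n.+1] itself. *)
Lemma is_derive_tpow n x : is_derive x 1 (tpow n.+2) (n.+2%:R * tpow n.+1 x).
Proof.
have [x0|x0|->] := ltrgtP x 0.
- apply: (@near_eq_is_derive _ _ _ (cst 0)).
    by near=> y; rewrite tpow_le0//; apply/ltW; near: y; exact: lt_nbhsl.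
  by rewrite tpow_le0 ?ltW// mulr0; exact: is_derive_cst.
- apply: (@near_eq_is_derive R R R (id ^+ n.+2)).
    by near=> y; rewrite tpow_ge0E ?exprfctE//; apply/ltW; near: y; exact: lt_nbhsr.
  have D := @is_deriveX R R id n.+2 x 1 1 (is_derive_id x 1).
  apply: is_derive_eq D _.
  by rewrite tpow_ge0E ?ltW// /GRing.scale/= mulr1.
- rewrite (@tpow_le0 n)// mulr0.
  have H : h^-1 *: (tpow n.+2 (h *: 1 + 0) - tpow n.+2 0) @[h --> 0^'] --> (0 : R).
    have -> : (fun h : R => h^-1 *: (tpow n.+2 (h *: 1 + 0) - tpow n.+2 0)) = tpow n.+1.
      apply/funext => h; rewrite (@tpow_le0 n.+1 0)// subr0 addr0 /GRing.scale/= mulr1.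
      have [h0|h0|->] := ltrgtP h 0.
      - by rewrite !tpow_le0 ?ltW// mulr0.
      - by rewrite !tpow_ge0E ?ltW// exprS mulKf// gt_eqF.
      - by rewrite !tpow_le0// mulr0.
    rewrite -[X in _ --> X](@tpow_le0 n 0)//.
    by apply: cvg_within_filter; exact: continuous_tpow.
  apply: DeriveDef; first by apply/cvg_ex; exists 0.
  exact: cvg_lim.
Unshelve. all: by end_near. Qed.

Lemma is_derive_cont f (df : R -> R) : (forall x, is_derive x 1 f (df x)) ->
  continuous f.
Proof.
move=> H x; apply: differentiable_continuous; apply/derivable1_diffP.
by have [] := H x.
Qed.

Lemma is_derive_derive1 f (df : R -> R) : (forall x, is_derive x 1 f (df x)) ->
  derive1 f = df.
Proof. by move=> H; apply/funext => x; rewrite derive1E; exact: derive_val. Qed.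

Lemma supp_sub_closure f A B : (forall x, x \notin `[A, B] -> f x = 0) ->
  closure [set x | f x != 0] `<=` `[A, B]%classic.
Proof.
move=> f0; rewrite [X in _ `<=` X](closure_id _).1; last exact: interval_closed.
apply: closureS => x /=; apply: contraR => xAB; apply/eqP/f0; exact/negP/negP.
Qed.

Lemma C1cI (U : set R) f (df : R -> R) A B :
  (forall x, is_derive x 1 f (df x)) -> continuous df ->
  (forall x, x \notin `[A, B] -> f x = 0) -> `[A, B]%classic `<=` U -> C1c U f.
Proof.
move=> H cdf f0 AU; split.
- by move=> x; have [] := H x.
- by rewrite (is_derive_derive1 H).
- apply: (@subclosed_compact _ _ `[A, B]%classic).
  + exact: closed_closure.
  + exact: segment_compact.
  + exact: supp_sub_closure.
- exact: subset_trans (supp_sub_closure f0) AU.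
Qed.

Lemma C1cD (U : set R) f g (k : R) : C1c U f -> C1c U g ->
  C1c U (fun x => f x + k * g x) /\
  derive1 (fun x => f x + k * g x) = (fun x => derive1 f x + k * derive1 g x).
Proof.
move=> [df cf kf sf] [dg cg kg sg].
have H x : is_derive x 1 (fun x => f x + k * g x) (derive1 f x + k * derive1 g x).
  rewrite !derive1E; apply: is_deriveD; first exact/derivableP/df.
  by apply: is_deriveZ; exact/derivableP/dg.
have D := is_derive_derive1 H.
have S : closure [set x | f x + k * g x != 0] `<=`
    closure [set x | f x != 0] `|` closure [set x | g x != 0].
  rewrite -closureU; apply: closureS => x /=.
  have [->|fx _] := eqVneq (f x) 0; last by left.
  by rewrite add0r mulf_eq0 negb_or => /andP[_ gx]; right.
split; last exact: D.
split.
- by move=> x; have [] := H x.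
- rewrite D => x; apply: continuousD; first exact: cf.
  by apply: continuousM; [exact: cst_continuous|exact: cg].
- apply: subclosed_compact S; first exact: closed_closure.
  exact: compactU.
- by apply: subset_trans S _; rewrite subUset; split.
Qed.

(** The interval is enlarged on both sides so that the boundary terms fall where
    [G] is known to vanish. *)
Lemma Rint_by_parts F G (f g : R -> R) A B :
  (forall x, is_derive x 1 F (f x)) -> continuous f ->
  (forall x, is_derive x 1 G (g x)) -> continuous g ->
  (forall x, x \notin `[A, B] -> G x = 0) ->
  (forall x, x \notin `[A, B] -> g x = 0) ->
  \int[mu]_x (F x * g x) = - \int[mu]_x (f x * G x).
Proof.
move=> dF cf dG cg G0 g0.
have G0' x : x \notin `[A - 1, B + 1] -> G x = 0.
  by move=> xAB; apply: G0; apply: contra xAB; rewrite !in_itv/=; lra.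
have g0' x : x \notin `[A - 1, B + 1] -> g x = 0.
  by move=> xAB; apply: g0; apply: contra xAB; rewrite !in_itv/=; lra.
rewrite (@Rintegral_supp _ (A - 1) (B + 1)); last first.
  by move=> x /g0' ->; rewrite mulr0.
rewrite (@Rintegral_supp (fun x => f x * G x) (A - 1) (B + 1)); last first.
  by move=> x /G0' ->; rewrite mulr0.
have [AB|AB] := ltP (A - 1) (B + 1); last first.
  have G00 : G = cst 0.
    apply/funext => x; apply: G0; rewrite in_itv/=; apply/negP; lra.
  have g00 : g = cst 0.
    apply/funext => x; apply: g0; rewrite in_itv/=; apply/negP; lra.
  rewrite G00 g00/=; under eq_Rintegral do rewrite mulr0.
  under [in RHS]eq_Rintegral do rewrite mulr0.
  by rewrite Rintegral_cst// mul0r oppr0.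
have LR (H h : R -> R) : (forall x, is_derive x 1 H (h x)) ->
    derivable_oo_LRcontinuous H (A - 1) (B + 1).
  move=> dH; have cH := is_derive_cont dH; split.
  - by move=> x _; have [] := dH x.
  - by apply: cvg_at_right_filter; exact: cH.
  - by apply: cvg_at_left_filter; exact: cH.
rewrite (Rintegration_by_parts AB (continuous_subspaceT cf) (LR _ _ dF) _
  (continuous_subspaceT cg) (LR _ _ dG)).
- rewrite (G0 (A - 1)) ?(G0 (B + 1)) ?mulr0 ?subrr ?sub0r//.
    by rewrite in_itv/=; apply/negP; lra.
  by rewrite in_itv/=; apply/negP; lra.
- by move=> x _; rewrite (is_derive_derive1 dF).
- by move=> x _; rewrite (is_derive_derive1 dG).
Qed.

Lemma is_derive_affine (f df : R -> R) (c k : R) :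
  (forall x, is_derive x 1 f (df x)) ->
  forall x, is_derive x 1 (fun y => f (k * y + c)) (k * df (k * x + c)).
Proof.
move=> H x.
have D1 : is_derive x 1 (fun y : R => k * y + c) k.
  have D0 := @is_deriveD R R R _ _ x 1 _ _
    (@is_deriveZ R R R id k x 1 1 (is_derive_id x 1)) (is_derive_cst c x 1).
  by apply: is_derive_eq D0 _; rewrite addr0 /GRing.scale/= mulr1.
have D2 := @is_derive1_comp R f (fun y : R => k * y + c) x _ _ (H _) D1.
by apply: is_derive_eq D2 _; rewrite mulrC.
Qed.

Definition bump A B (x : R) : R := tpow 2 (x - A) * tpow 2 (B - x).

Definition dbump A B (x : R) : R :=
  tpow 2 (x - A) * - (2 * tpow 1 (B - x)) + tpow 2 (B - x) * (2 * tpow 1 (x - A)).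

Lemma is_derive_bump A B x : is_derive x 1 (bump A B) (dbump A B x).
Proof.
have D1 := is_derive_affine (- A) 1 (is_derive_tpow 0) x.
have D2 := is_derive_affine B (-1) (is_derive_tpow 0) x.
have D := @is_deriveM R R _ _ x 1 _ _ D1 D2.
have -> : bump A B = (fun y => tpow 2 (1 * y - A)) * (fun y => tpow 2 (-1 * y + B)).
  by apply/funext => y; rewrite /bump fctE/= mul1r mulN1r (addrC B).
apply: is_derive_eq D _.
by rewrite /dbump /GRing.scale/= !mul1r !mulN1r (addrC (-x)).
Qed.

Lemma continuous_dbump A B : continuous (dbump A B).
Proof.
have c1 n : continuous (fun x : R => tpow n (x - A)).
  move=> x; apply: (@continuous_comp _ _ _ (fun x : R => x - A)).
    by apply: continuousB => //; exact: cst_continuous.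
  exact: continuous_tpow.
have c2 n : continuous (fun x : R => tpow n (B - x)).
  move=> x; apply: (@continuous_comp _ _ _ (fun x : R => B - x)).
    by apply: continuousB => //; exact: cst_continuous.
  exact: continuous_tpow.
move=> x; apply: cvgD; apply: cvgM; [exact: c1| |exact: c2|].
  by apply: cvgN; apply: cvgM; [exact: cvg_cst|exact: c2].
by apply: cvgM; [exact: cvg_cst|exact: c1].
Qed.

Lemma bump_gt0 A B x : x \in `]A, B[ -> 0 < bump A B x.
Proof.
rewrite in_itv/= => /andP[Ax xB].
by rewrite /bump !tpow_ge0E ?mulr_gt0 ?exprn_gt0 ?subr_gt0// subr_ge0 ltW.
Qed.

Lemma bump_eq0 A B x : x \notin `]A, B[ -> bump A B x = 0.
Proof.
rewrite in_itv/= negb_and -!leNgt => /orP[xA|Bx].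
  by rewrite /bump tpow_le0 ?mul0r// subr_le0.
by rewrite /bump (@tpow_le0 _ (B - x)) ?mulr0// subr_le0.
Qed.

Lemma bump_ge0 A B x : 0 <= bump A B x.
Proof. by rewrite mulr_ge0// tpow_ge0. Qed.

(** Equal to n bump / (1 + n bump): a C^1 function with values in [0, 1] that
    increases to the indicator of ]A, B[ with n. *)
Definition plateau n A B (x : R) : R := 1 - (1 + n%:R * bump A B x)^-1.

Lemma plateau_den n A B x : 1 <= 1 + n%:R * bump A B x.
Proof. by rewrite lerDl mulr_ge0// bump_ge0. Qed.

Lemma plateau_bnd n A B x : 0 <= plateau n A B x <= 1.
Proof.
have d := plateau_den n A B x.
rewrite subr_ge0 invf_le1 ?(lt_le_trans ltr01)// d/= gerBl invr_ge0.
exact: le_trans d.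
Qed.

Lemma plateau_cvg A B x :
  plateau n A B x @[n --> \oo] --> (\1_`]A, B[%classic x : R).
Proof.
rewrite indicE mem_setE; have [xAB|xAB] := boolP (x \in `]A, B[); last first.
  rewrite (_ : (fun n => _) = cst 0); first exact: cvg_cst.
  by apply/funext => n; rewrite /plateau bump_eq0// mulr0 addr0 invr1 subrr.
have b0 := bump_gt0 xAB.
rewrite -[X in _ --> X]subr0; apply: cvgB; first exact: cvg_cst.
apply/gtr0_cvgV0.
  by apply: nearW => n; rewrite (lt_le_trans ltr01)// plateau_den.
apply/cvgryPge => M; near=> n.
rewrite (@le_trans _ _ (n%:R * bump A B x))//; last by rewrite lerDr.
rewrite -ler_pdivrMr//; near: n; exact: nbhs_infty_ger.
Unshelve. all: by end_near. Qed.

Lemma C1c_plateau n A B : C1c setT (plateau n A B).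
Proof.
pose den x := 1 + n%:R * bump A B x.
have den0 x : den x != 0 by rewrite gt_eqF// (lt_le_trans ltr01)// plateau_den.
have Dden x : is_derive x 1 den (n%:R * dbump A B x).
  have D := @is_deriveD R R R _ _ x 1 _ _ (is_derive_cst (1 : R) x 1)
    (@is_deriveZ R R R _ n%:R x 1 _ (is_derive_bump A B x)).
  by apply: is_derive_eq D _; rewrite add0r.
have cden := is_derive_cont Dden.
have Dp x : is_derive x 1 (plateau n A B) ((den x ^+ 2)^-1 * (n%:R * dbump A B x)).
  have D := @is_deriveB R R R _ _ x 1 _ _ (is_derive_cst (1 : R) x 1)
     (is_deriveV (den0 x) (Dden x)).
  by apply: is_derive_eq D _; rewrite sub0r /GRing.scale/= mulNr opprK.
apply: (C1cI (A := A) (B := B) Dp) => //.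
- move=> x; apply: cvgM.
    apply: cvgV; first by rewrite expf_neq0.
    by apply: (@continuous_comp _ _ _ den (fun y => y ^+ 2));
      [exact: cden|exact: exprn_continuous].
  by apply: cvgM; [exact: cvg_cst|exact: continuous_dbump].
- move=> x xAB; rewrite /plateau bump_eq0 ?mulr0 ?addr0 ?invr1 ?subrr//.
  by apply: contra xAB; exact: subset_itv_oo_cc.
Qed.

Lemma Lfun2_integrable_itv f A B : f \in Lfun mu 2%:E ->
  mu.-integrable `[A, B] (EFin \o f).
Proof.
move=> lf; have i1 : (\1_`[A, B] : R -> R) \in Lfun mu 2%:E.
  rewrite inE; apply/andP; split; rewrite inE/=; first exact: measurable_indic.
  rewrite /finite_norm unlock poweR_lty//.
  have -> : (\int[mu]_x `|(EFin \o \1_`[A, B]) x| `^ 2 =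
           \int[mu]_x (\1_`[A, B] x)%:E)%E.
    apply: eq_integral => x _ /=.
    rewrite powR_mulrn// indicE.
    by case: (_ \in _); rewrite ?normr1 ?normr0 ?expr1n ?expr0n.
  rewrite integral_indic// setIT.
  by apply: compact_finite_measure; exact: segment_compact.
have := Lfun2_mul_integrable lf i1.
move=> H; rewrite -[X in _.-integrable X _]setTI; apply/integrable_restrict => //.
by congr (_.-integrable _ _) : H; apply/funext => x; rewrite restrict_EFin/= patchE indicE;
   case: (_ \in _); rewrite ?mulr1 ?mulr0.
Qed.

Lemma Lfun2_locally f : f \in Lfun mu 2%:E -> locally_integrable setT f.
Proof.
move=> lf; have mf : measurable_fun setT f.
  by move: lf; rewrite inE => /andP[]; rewrite inE.
split=> //; first exact: openT.
move=> K _ cK; have [M [Mr HM]] := compact_bounded cK.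
have KM : K `<=` `[- (M + 1), M + 1].
  have MM : M < M + 1 by rewrite ltrDl.
  by move=> x /(HM _ MM) /=; rewrite in_itv/= ler_norml.
have mK := compact_measurable cK.
have /integrableP[_//] : mu.-integrable K (EFin \o f).
by apply: integrableS (Lfun2_integrable_itv (- (M + 1)) (M + 1) lf).
Qed.

(** Plateaus are admissible test functions converging to indicators, so by
    dominated convergence the integral of [f] over every interval vanishes; by
    Lebesgue differentiation [f] vanishes at each of its Lebesgue points. *)
Lemma ae_eq0_C1c f : f \in Lfun mu 2%:E ->
  (forall phi, C1c setT phi -> \int[mu]_x (f x * phi x) = 0) ->
  {ae mu, forall x, f x = 0}.
Proof.
move=> lf f0; have fi A B := Lfun2_integrable_itv A B lf.
have mf : measurable_fun setT f.
  by move: lf; rewrite inE => /andP[]; rewrite inE.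
have F0 A B : \int[mu]_(x in `[A, B]) f x = 0.
  have i0 : forall n, (\int[mu]_(x in `[A, B]) (f x * plateau n A B x)%:E = 0)%E.
    move=> n; have [dp _ _ _] := C1c_plateau n A B.
    have cp : continuous (plateau n A B).
      by move=> x; apply/differentiable_continuous/derivable1_diffP.
    have p0 x : x \notin `[A, B] -> plateau n A B x = 0.
      move=> xAB; rewrite /plateau bump_eq0 ?mulr0 ?addr0 ?invr1 ?subrr//.
      by apply: contra xAB; exact: subset_itv_oo_cc.
    have ip := Lfun2_mul_integrable lf (Lfun2_cc cp p0).
    have := f0 _ (C1c_plateau n A B).
    rewrite (@Rintegral_supp _ A B); last by move=> x /p0 ->; rewrite mulr0.
    rewrite /Rintegral => H; rewrite -[LHS]fineK ?H//.
    by apply: integrable_fin_num => //; exact: integrableS ip.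
  have [] := @dominated_convergence _ _ R mu `[A, B] (measurable_itv _)
    (fun n x => (f x * plateau n A B x)%:E) (fun x => (f x * \1_`]A, B[ x)%:E)
    (fun x => `|(f x)%:E|%E).
  - move=> n; apply/measurable_EFinP; apply: measurable_funTS.
    apply: measurable_funM => //; apply: continuous_measurable_fun => x.
    by apply/differentiable_continuous/derivable1_diffP; have [] := C1c_plateau n A B.
  - apply/measurable_EFinP; apply: measurable_funTS.
    by apply: measurable_funM => //; exact: measurable_indic.
  - apply: aeW => x _; apply: cvg_EFin; first exact: nearW.
    by apply: cvgM; [exact: cvg_cst|exact: plateau_cvg].
  - exact: integrable_abse.
  - apply: aeW => x n _; rewrite lee_fin normrM ler_piMr//.
    by have /andP[? ?] := plateau_bnd n A B x; rewrite ger0_norm.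
  move=> _ _; rewrite (_ : (fun n => _) = cst 0%E); last by apply/funext.
  move=> /(cvg_unique _ (@cvg_cst _ _ _ _ _)) => /(_ (@ereal_hausdorff R)) H.
  rewrite -Rintegral_itv_bndo_bndc; last first.
    by apply: integrableS (fi A B) => //; exact: subset_itv_co_cc.
  rewrite -Rintegral_itv_obnd_cbnd; last first.
    by apply: integrableS (fi A B) => //; exact: subset_itv_oo_cc.
  rewrite Rintegral_mkcond.
  move: H; rewrite integral_mkcond /Rintegral => H; rewrite (_ : (\int[mu]_x _)%E = 0%E)//.
  rewrite H; apply: eq_integral => x _.
  rewrite !patchE indicE !mem_setE; case: ifPn => [xAB|_].
    by rewrite subset_itv_oo_cc// mulr1.
  by rewrite mulr0 if_same.
have := lebesgue_differentiation (Lfun2_locally lf).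
apply: filterS; first exact: (ae_filter_ringOfSetsType mu).
move=> x xl.
have [] := @FTC1_lebesgue_pt R f (BLeft (x - 1)) x (x + 1) _ (fi _ _) _ xl.
- by rewrite ltrDl.
- by rewrite lte_fin ltrBlDr ltrDl.
- move=> _ <-; rewrite (_ : (fun y => _) = cst 0); first by rewrite derive1_cst.
  by apply/funext => y; rewrite F0.
Qed.

End CompactSupport.

(** * Weak derivatives and the first variation of the energy *)

Section WeakForm.
Context {R : realType}.
Notation mu := (@lebesgue_measure R).
Implicit Types (u v g phi psi : R -> R) (a b x k : R).

(** The support is compact, hence bounded; the derivative vanishes off the
    closure because [phi] is locally zero there. *)
Lemma C1c_supp (U : set R) phi : C1c U phi -> exists A B : R,
  (forall x, x \notin `[A, B] -> phi x = 0) /\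
  (forall x, x \notin `[A, B] -> derive1 phi x = 0).
Proof.
move=> [dp cp kp _]; have [M [Mr HM]] := compact_bounded kp.
have MM : M < M + 1 by rewrite ltrDl.
exists (- (M + 1)), (M + 1).
have S x : x \notin `[- (M + 1), M + 1] -> ~ closure [set x | phi x != 0] x.
  move=> + /(HM _ MM) /=; rewrite in_itv/= ler_norml.
  by move=> /negP.
split=> x /S xS.
  by have [//|px] := eqVneq (phi x) 0; exfalso; apply: xS; exact: subset_closure.
have : nbhs x (~` closure [set x | phi x != 0]).
  by apply: open_nbhs_nbhs; split=> //; exact/closed_openC/closed_closure.
move=> nx; rewrite derive1E.
rewrite (@near_eq_derive _ _ _ phi (cst 0)) ?derive_cst ?oner_eq0//.
apply: filterS nx => z zS.
by have [//|px] := eqVneq (phi z) 0; exfalso; apply: zS; exact: subset_closure.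
Qed.

Lemma C1c_continuous (U : set R) phi : C1c U phi -> continuous phi.
Proof.
by move=> [dp _ _ _] x; apply/differentiable_continuous/derivable1_diffP.
Qed.

Lemma C1c_Lfun2 (U : set R) phi : C1c U phi ->
  phi \in Lfun mu 2%:E /\ derive1 phi \in Lfun mu 2%:E.
Proof.
move=> Cp; have [A [B [p0 dp0]]] := C1c_supp Cp.
split; first exact: Lfun2_cc (C1c_continuous Cp) p0.
by case: Cp => _ cp _ _; exact: Lfun2_cc cp dp0.
Qed.

Lemma Lfun2D v g k : v \in Lfun mu 2%:E -> g \in Lfun mu 2%:E ->
  (fun x => v x + k * g x) \in Lfun mu 2%:E.
Proof.
move=> lv lg; have p1 : (1 <= 2%:E :> \bar R)%E by rewrite lee_fin ler1n.
have := (Lfun_submod_closed mu p1).2 k g v lg lv.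
rewrite (_ : k *: g + v = fun x => v x + k * g x)//.
by apply/funext => x; rewrite addrC.
Qed.

Lemma Rintegral_lin (f g : R -> R) k :
  mu.-integrable setT (EFin \o f) -> mu.-integrable setT (EFin \o g) ->
  \int[mu]_x (f x + k * g x) = \int[mu]_x f x + k * \int[mu]_x g x.
Proof.
move=> fi gi; rewrite RintegralD ?RintegralZl//.
exact: (integrableZl _ k gi).
Qed.

Lemma integrable_lin (f g : R -> R) k :
  mu.-integrable setT (EFin \o f) -> mu.-integrable setT (EFin \o g) ->
  mu.-integrable setT (EFin \o (fun x => f x + k * g x)).
Proof.
by move=> fi gi; apply: (integrableD _ fi (integrableZl _ k gi)).
Qed.

Lemma C1c_by_parts (U V : set R) phi psi : C1c U phi -> C1c V psi ->
  \int[mu]_x (phi x * derive1 psi x) = - \int[mu]_x (derive1 phi x * psi x).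
Proof.
move=> Cp Cq; have [A [B [p0 dp0]]] := C1c_supp Cq.
case: Cp Cq => [dp cp _ _] [dq cq _ _].
apply: Rint_by_parts cp _ cq p0 dp0.
- by move=> x; rewrite derive1E; exact/derivableP.
- by move=> x; rewrite derive1E; exact/derivableP.
Qed.

Lemma is_weak_deriv_perturb (U : set R) v g phi k :
  v \in Lfun mu 2%:E -> is_weak_deriv v g ->
  C1c U phi -> is_weak_deriv (fun x => v x + k * phi x)
                             (fun x => g x + k * derive1 phi x).
Proof.
move=> lv [lg vg] Cp; have [lp ldp] := C1c_Lfun2 Cp.
split=> [|psi Cq]; first exact: Lfun2D.
have [lq ldq] := C1c_Lfun2 Cq.
have I := Lfun2_mul_integrable.
under eq_Rintegral do rewrite mulrDl -mulrA.
under [in RHS]eq_Rintegral do rewrite mulrDl -mulrA.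
rewrite !Rintegral_lin; [|exact: I..].
by rewrite (vg _ Cq) (C1c_by_parts Cp Cq); ring.
Qed.

Lemma is_weak_deriv_ae v g1 g2 : is_weak_deriv v g1 -> is_weak_deriv v g2 ->
  {ae mu, forall x, g1 x = g2 x}.
Proof.
move=> [l1 H1] [l2 H2].
have : {ae mu, forall x, g1 x + (- 1) * g2 x = 0}.
  apply: ae_eq0_C1c; first exact: Lfun2D.
  move=> phi Cp; have [lp _] := C1c_Lfun2 Cp.
  under eq_Rintegral do rewrite mulrDl -mulrA.
  rewrite Rintegral_lin; [|exact: Lfun2_mul_integrable..].
  apply: oppr_inj; rewrite opprD -mulrN -(H1 _ Cp) -(H2 _ Cp); ring.
apply: filterS; first exact: (ae_filter_ringOfSetsType mu).
by move=> x; rewrite mulN1r => /subr0_eq.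
Qed.

Lemma weak_derivP v : H1 v -> is_weak_deriv v (weak_deriv v).
Proof. by move=> [_ ex]; exact: xgetPex. Qed.

Lemma H1_perturb (U : set R) v phi k : H1 v -> C1c U phi ->
  H1 (fun x => v x + k * phi x).
Proof.
move=> Hv Cp; have [lp _] := C1c_Lfun2 Cp; case: (Hv) => lv _.
split; first exact: Lfun2D.
by exists (fun x => weak_deriv v x + k * derive1 phi x);
  apply: is_weak_deriv_perturb Cp => //; exact: weak_derivP.
Qed.

(** [weak_deriv] selects a representative separately for each function, so linearity
    holds only almost everywhere; energies and norms see nothing more. *)
Lemma weak_deriv_perturb (U : set R) v phi k : H1 v -> C1c U phi ->
  {ae mu, forall x, weak_deriv (fun y => v y + k * phi y) x =
                    weak_deriv v x + k * derive1 phi x}.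
Proof.
move=> Hv Cp; apply: (@is_weak_deriv_ae (fun y => v y + k * phi y)).
  by apply: weak_derivP; exact: H1_perturb Cp.
by case: (Hv) => lv _; apply: is_weak_deriv_perturb Cp => //; exact: weak_derivP.
Qed.

Lemma Lfun2_measurable g : g \in Lfun mu 2%:E -> measurable_fun setT g.
Proof. by rewrite inE => /andP[]; rewrite inE. Qed.

Lemma Lnorm_ae (f g : R -> R) : measurable_fun setT f -> measurable_fun setT g ->
  {ae mu, forall x, f x = g x} ->
  ('N[mu]_2%:E[EFin \o f] = 'N[mu]_2%:E[EFin \o g])%E.
Proof.
move=> mf mg fg; rewrite unlock; apply: (congr1 (fun z => z `^ 2^-1)%E).
have M (h : R -> R) : measurable_fun setT h ->
    measurable_fun setT (fun x => (`|(EFin \o h) x| `^ 2)%E).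
  move=> mh; apply/measurable_EFinP.
  apply/(@measurableT_comp _ _ _ _ _ _ (fun x : R => x `^ 2)%R) => //.
  exact/measurableT_comp.
apply: ae_eq_integral => //; [exact: M|exact: M|].
apply: filterS fg; first exact: (ae_filter_ringOfSetsType mu).
by move=> x /= -> _.
Qed.

(** If [psi] approximates [v] then [psi + k phi] approximates [v + k phi] with the
    same errors. *)
Lemma H10_perturb v a b phi k : H10 a b v -> C1c `]a, b[%classic phi ->
  H10 a b (fun x => v x + k * phi x).
Proof.
move=> [Hv cv v0 av] Cp; have cp := C1c_continuous Cp.
split.
- exact: H1_perturb Cp.
- by move=> x; apply: cvgD; [exact: cv|apply: cvgM; [exact: cvg_cst|exact: cp]].
- move=> x xab; rewrite v0// add0r.
  have [->|px] := eqVneq (phi x) 0; first by rewrite mulr0.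
  case: Cp => _ _ _ /(_ x) H; exfalso; move/negP: xab; apply.
  by apply: H; exact: subset_closure.
move=> e e0; have [psi [Cq n1 n2]] := av e e0.
have [C D] := C1cD k Cq Cp.
have [_ ldp] := C1c_Lfun2 Cp; have [_ ldq] := C1c_Lfun2 Cq.
exists (fun x => psi x + k * phi x); split => //.
  rewrite (_ : _ \- _ = v \- psi)//.
  by apply/funext => x /=; ring.
rewrite D; rewrite (@Lnorm_ae _ (weak_deriv v \- derive1 psi))//.
- apply: measurable_funB; apply: Lfun2_measurable; last exact: Lfun2D.
  by have [] := weak_derivP (H1_perturb k Hv Cp).
- apply: measurable_funB; apply: Lfun2_measurable => //.
  by have [] := weak_derivP Hv.
- have := weak_deriv_perturb k Hv Cp.
  apply: filterS; first exact: (ae_filter_ringOfSetsType mu).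
  by move=> x /= ->; ring.
Qed.


Lemma integrable_mulx v a b : continuous v ->
  (forall x, x \notin `]a, b[ -> v x = 0) ->
  mu.-integrable setT (EFin \o (fun x => v x * x)).
Proof.
move=> cv v0; apply: (@integrable_cc _ _ a b).
  by move=> x; apply: cvgM; [exact: cv|exact: cvg_id].
move=> x xab; rewrite v0 ?mul0r//.
by apply: contra xab; exact: subset_itv_oo_cc.
Qed.

Lemma energy_perturb (kappa alpha : R) v a b phi k :
  let c := kappa * cos alpha in let s := kappa * sin alpha in
  H10 a b v -> C1c `]a, b[%classic phi ->
  energy kappa alpha (fun x => v x + k * phi x) = energy kappa alpha v +
    k * (\int[mu]_x (weak_deriv v x * derive1 phi x + c * (v x * phi x)
                     - s * (phi x * x))) +
    k ^+ 2 * (2^-1 * \int[mu]_x (derive1 phi x ^+ 2 + c * phi x ^+ 2)).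
Proof.
move=> c s [Hv cv v0 _] Cp.
have [lg _] := weak_derivP Hv; have [lv _] := Hv; have [lp ldp] := C1c_Lfun2 Cp.
set g := weak_deriv v in lg *.
have p0 x : x \notin `]a, b[ -> phi x = 0.
  move=> xab; have [//|px] := eqVneq (phi x) 0.
  case: Cp => _ _ _ /(_ x) H; exfalso; move/negP: xab; apply.
  by apply: H; exact: subset_closure.
have I := Lfun2_mul_integrable.
have ivx := integrable_mulx cv v0.
have ipx := integrable_mulx (C1c_continuous Cp) p0.
have i1 : mu.-integrable setT (EFin \o (fun x => g x * derive1 phi x + c * (v x * phi x)
                     - s * (phi x * x))).
  have := integrable_lin (- s) (integrable_lin c (I _ _ _ lg ldp) (I _ _ _ lv lp)) ipx.
  by congr (_.-integrable _ _); apply/funext => x /=; congr EFin; ring.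
have i2 : mu.-integrable setT (EFin \o (fun x => derive1 phi x ^+ 2 + c * phi x ^+ 2)).
  have := integrable_lin c (I _ _ _ ldp ldp) (I _ _ _ lp lp).
  by congr (_.-integrable _ _); apply/funext => x /=; congr EFin; ring.
have i0 : mu.-integrable setT (EFin \o (fun x =>
    2^-1 * `|g x| ^+ 2 + v x ^+ 2 / 2 * c - v x * x * s)).
  have := integrable_lin (- s) (integrable_lin (c / 2)
    (integrableZl measurableT 2^-1 (I _ _ _ lg lg)) (I _ _ _ lv lv)) ivx.
  congr (_.-integrable _ _); apply/funext => x /=; congr EFin.
  by rewrite real_normK ?num_real//; ring.
rewrite /energy -/c -/s -/g mulrA -Rintegral_lin// -Rintegral_lin//;
  last exact: integrable_lin.
have [lgk _] := weak_derivP (H1_perturb k Hv Cp).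
have lvk : (fun x => v x + k * phi x) \in Lfun mu 2%:E by exact: Lfun2D.
congr fine; apply: ae_eq_integral => //.
- apply/measurable_EFinP; apply: measurable_funB.
    apply: measurable_funD.
      apply: measurable_funM => //; apply: measurable_funX.
      by apply: measurableT_comp => //; exact: Lfun2_measurable.
    by do 2 (apply: measurable_funM => //); apply: measurable_funX; exact: Lfun2_measurable.
  do 2 (apply: measurable_funM => //).
  exact: Lfun2_measurable.
- by have /integrableP[] := integrable_lin (k ^+ 2 / 2) (integrable_lin k i0 i1) i2.
have := weak_deriv_perturb k Hv Cp.
apply: filterS; first exact: (ae_filter_ringOfSetsType mu).
move=> x /= -> _; congr EFin; rewrite -/g !real_normK ?num_real//.
by field.
Qed.

(** On the compact support of [phi] the continuous function [u] has a positive
    minimum, so [u + k phi] competes with [u] for all small [k] of either sign;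
    the energy is a quadratic polynomial in [k] whose linear coefficient must
    therefore vanish. *)
Lemma argmin_first_variation (V0 kappa alpha : R) u a b phi dphi A B :
  let c := kappa * cos alpha in let s := kappa * sin alpha in
  [set x | 0 < u x] = `]a, b[%classic -> is_argmin V0 kappa alpha a b u ->
  a < A -> A < B -> B < b ->
  (forall x, is_derive x 1 phi (dphi x)) -> continuous dphi ->
  (forall x, x \notin `[A, B] -> phi x = 0) ->
  \int[mu]_x phi x = 0 ->
  \int[mu]_x (weak_deriv u x * dphi x + c * (u x * phi x) - s * (phi x * x)) = 0.
Proof.
move=> c s upos [[Hu u0 uV] umin] aA AB Bb dphiP cdphi phi0 phiI.
have Cp : C1c `]a, b[%classic phi.
  apply: C1cI dphiP cdphi phi0 _.
  by move=> x; rewrite /= !in_itv/=; lra.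
have dE : derive1 phi = dphi by exact: is_derive_derive1.
have cp := C1c_continuous Cp.
have [Hv cu uout _] := Hu.
have [m mAB mmin] := EVT_min (ltW AB)
  (continuous_subspaceT cu : {within `[A, B], continuous u}).
have [M MAB Mmax] := EVT_max (ltW AB)
  (continuous_subspaceT (fun x => continuous_comp (cp x) (@norm_continuous _ _ _)) :
     {within `[A, B], continuous (fun x => `|phi x|)}).
have um0 : 0 < u m.
  have : [set x | 0 < u x] m by rewrite upos /=; move: mAB; rewrite !in_itv/=; lra.
  by [].
set J := \int[mu]_x _.
pose Q := 2^-1 * \int[mu]_x (derive1 phi x ^+ 2 + c * phi x ^+ 2).
(* the added 1 avoids a case distinction on phi M = 0 *)
pose k0 := u m / (`|phi M| + 1).
have k00 : 0 < k0 by rewrite divr_gt0// ltr_wpDl.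
have E k : `|k| <= k0 -> 0 <= k * J + k ^+ 2 * Q.
  move=> kk0.
  have adm : admissible_profile V0 a b (fun x => u x + k * phi x).
    split; first exact: H10_perturb.
      move=> x; have [xAB|/phi0 ->] := boolP (x \in `[A, B]); last by rewrite mulr0 addr0.
      rewrite -lerBlDr sub0r; apply: le_trans (mmin x xAB).
      apply: (@le_trans _ _ (`|k| * `|phi x|)); first by rewrite -normrM -normrN ler_norm.
      apply: (@le_trans _ _ (k0 * `|phi M|)).
        by apply: ler_pM => //; exact: Mmax.
      by rewrite /k0 mulrAC ler_pdivrMr ?ltr_wpDl// ler_pM2l// lerDl.
    have pab x : x \notin `]a, b[ -> phi x = 0.
      move=> xab; apply: phi0; apply: contra xab; rewrite !in_itv/=; lra.
    have out (f : R -> R) : (forall x, x \notin `]a, b[ -> f x = 0) ->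
        \int[mu]_(x in `]a, b[) f x = \int[mu]_x f x.
      move=> f0; rewrite Rintegral_mkcond; congr (Rintegral _ _ _).
      apply/funext => x; rewrite patchE; case: ifPn => // xab.
      by rewrite f0//; apply: contra xab => xab; rewrite inE.
    rewrite out; last by move=> x xab; rewrite uout// pab// mulr0 addr0.
    rewrite Rintegral_lin.
    - by rewrite phiI mulr0 addr0 -out.
    - apply: (@integrable_cc _ _ a b) => // x xab; apply: uout.
      by apply: contra xab; exact: subset_itv_oo_cc.
    - exact: integrable_cc cp phi0.
  have := umin _ adm; rewrite (energy_perturb kappa alpha k Hu Cp) dE -/J.
  by rewrite /Q dE -addrA lerDl.
(* small enough for the linear term to dominate the quadratic one *)
pose t := Num.min k0 (`|J| / (`|Q| + 1)).
have [//|J0] := eqVneq J 0.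
have t0 : 0 < t by rewrite lt_min k00 divr_gt0 ?normr_gt0// ltr_wpDl.
have tQ : t * Q < `|J|.
  apply: (@le_lt_trans _ _ (t * `|Q|)); first by rewrite ler_pM2l// ler_norm.
  apply: (@lt_le_trans _ _ (t * (`|Q| + 1))); first by rewrite ltr_pM2l// ltrDl.
  by rewrite -ler_pdivlMr ?ltr_wpDl// ge_min lexx orbT.
have tk : `|t| <= k0 by rewrite gtr0_norm// ge_min lexx.
have := E t tk; have := E (- t); rewrite normrN => /(_ tk).
case: (ltrgtP J 0) (J0) tQ => // [Jn|Jp] _.
  rewrite ltr0_norm// => tQ _; nra.
rewrite gtr0_norm// => tQ; nra.
Qed.

End WeakForm.

(** * Cubic splines as test functions *)

Section Spline.
Context {R : realType}.
Notation mu := (@lebesgue_measure R).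
Implicit Types (f : R -> R) (a b x k e : R).

(** Integrating from minus infinity makes the primitive differentiable on the
    whole line; this is possible because [f] vanishes far to the left. *)
Lemma antiderivative f a : continuous f -> (forall x, x <= a -> f x = 0) ->
  exists F : R -> R, (forall x, is_derive x 1 F (f x)) /\
                     (forall x, x <= a -> F x = 0).
Proof.
move=> cf f0; exists (fun x => \int[mu]_(t in `]-oo, x]) f t); split=> x.
  have fi : mu.-integrable `]-oo, (x + 1)] (EFin \o f).
    have H : mu.-integrable `[a, (x + 1)] (EFin \o f).
      apply: continuous_compact_integrable; first exact: segment_compact.
      exact: continuous_subspaceT.
    move: H; rewrite integrable_mkcond// => H.
    rewrite integrable_mkcond//; congr (_.-integrable _ _) : H.
    apply/funext => y; rewrite !patchE !mem_setE !in_itv/=.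
    case: (leP a y) => //= ya; case: ifP => // _; by rewrite f0 ?ltW.
  have [] := @continuous_FTC1 R f -oo%O x (x + 1) _ fi _ (cf x).
  - by rewrite ltrDl.
  - exact: ltNyr.
  by move=> dF <-; rewrite derive1E; exact/derivableP.
move=> xa; rewrite (@eq_Rintegral _ _ _ _ _ (cst 0)) ?Rintegral_cst ?mul0r//.
by move=> y; rewrite inE/= in_itv/= => yx; rewrite f0// (le_trans yx).
Qed.

Lemma Rintegral_FTC f F A B : A < B ->
  (forall x, is_derive x 1 F (f x)) -> continuous f ->
  \int[mu]_(x in `[A, B]) f x = F B - F A.
Proof.
move=> AB dF cf; have cF := is_derive_cont dF.
rewrite /Rintegral (@continuous_FTC2 _ f F A B)//.
- exact: continuous_subspaceT.
- split.
  + by move=> x _; have [] := dF x.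
  + by apply: cvg_at_right_filter; exact: cF.
  + by apply: cvg_at_left_filter; exact: cF.
- by move=> x _; rewrite (is_derive_derive1 dF).
Qed.

(** The centered second difference, with step [e] around [k], of the truncated
    power.  For [n = 1] it is the hat function of height [e] on [k - e, k + e]; the
    higher [n] are its successive antiderivatives, up to a factor. *)
Definition hat n e k x : R :=
  tpow n (x - (k - e)) - 2 * tpow n (x - k) + tpow n (x - (k + e)).

Lemma is_derive_shift_tpow n k x :
  is_derive x 1 (fun y => tpow n.+2 (y - k)) (n.+2%:R * tpow n.+1 (x - k)).
Proof.
have D := is_derive_affine (- k) 1 (is_derive_tpow n) x.
rewrite (_ : (fun _ => _) = fun y => tpow n.+2 (1 * y - k)); last first.
  by apply/funext => y; rewrite mul1r.
by apply: is_derive_eq D _; rewrite !mul1r.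
Qed.

Lemma continuous_shift_tpow n k : continuous (fun y : R => tpow n (y - k)).
Proof.
move=> x; apply: (@continuous_comp _ _ _ (fun x : R => x - k)).
  by apply: cvgB => //; exact: cvg_cst.
exact: continuous_tpow.
Qed.

Lemma is_derive_lin (f g : R -> R) (df dg : R) k x :
  is_derive x 1 f df -> is_derive x 1 g dg ->
  is_derive x 1 (fun y => f y + k * g y) (df + k * dg).
Proof.
by move=> Df Dg; apply: (is_deriveD Df (@is_deriveZ R R R g k x 1 _ Dg)).
Qed.

Lemma continuous_lin (f g : R -> R) k :
  continuous f -> continuous g -> continuous (fun y => f y + k * g y).
Proof.
move=> cf cg x; apply: cvgD; first exact: cf.
by apply: cvgM; [exact: cvg_cst|exact: cg].
Qed.

Lemma is_derive_hat n e k x :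
  is_derive x 1 (hat n.+2 e k) (n.+2%:R * hat n.+1 e k x).
Proof.
have D z := is_derive_shift_tpow n z.
have H := is_derive_lin 1 (is_derive_lin (-2) (D (k - e) x) (D k x)) (D (k + e) x).
rewrite (_ : hat n.+2 e k = fun y => tpow n.+2 (y - (k - e)) + -2 * tpow n.+2 (y - k) +
   1 * tpow n.+2 (y - (k + e))); last by apply/funext => y; rewrite /hat mul1r mulNr.
by apply: is_derive_eq H _; rewrite /hat; ring.
Qed.

Lemma continuous_hat n e k : continuous (hat n e k).
Proof.
move=> x; apply: cvgD; last exact: continuous_shift_tpow.
apply: cvgB; first exact: continuous_shift_tpow.
by apply: cvgM; [exact: cvg_cst|exact: continuous_shift_tpow].
Qed.

Lemma hat_left n e k x : 0 < e -> x <= k - e -> hat n.+1 e k x = 0.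
Proof. by move=> e0 xk; rewrite /hat !tpow_le0; [ring|lra..]. Qed.

Lemma hat_right n e k x : 0 < e -> k + e <= x -> hat n e k x =
  (x - (k - e)) ^+ n - 2 * (x - k) ^+ n + (x - (k + e)) ^+ n.
Proof. by move=> e0 xk; rewrite /hat !tpow_ge0E; [|lra..]. Qed.

Lemma hat1_out e k x : 0 < e -> x \notin `[k - e, k + e] -> hat 1 e k x = 0.
Proof.
move=> e0; rewrite in_itv/= negb_and -!ltNge => /orP[xk|xk].
  by rewrite hat_left// ltW.
by rewrite hat_right ?ltW//; ring.
Qed.

Lemma hat1_ge0 e k x : 0 < e -> 0 <= hat 1 e k x.
Proof.
move=> e0; have [xk|xk] := leP x (k - e); first by rewrite hat_left.
have [xk'|xk'] := leP (k + e) x; first by rewrite hat_right//; lra.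
rewrite /hat (@tpow_ge0E _ _ (x - (k - e))); last lra.
rewrite (@tpow_le0 _ _ (x - (k + e))); last lra.
have [x0|x0] := leP x k.
  by rewrite tpow_le0 ?subr_le0//; lra.
by rewrite tpow_ge0E; lra.
Qed.

Lemma Rintegral_hat1 e k : 0 < e -> \int[mu]_x hat 1 e k x = e ^+ 2.
Proof.
move=> e0; rewrite (@Rintegral_supp _ _ (k - e) (k + e)); last first.
  by move=> x; exact: hat1_out.
have dF x : is_derive x 1 (fun y => cst 0 y + 2^-1 * hat 2 e k y) (hat 1 e k x).
  have H := @is_derive_lin (cst 0) _ 0 _ 2^-1 x (is_derive_cst _ _ _) (is_derive_hat 0 e k x).
  by apply: is_derive_eq H _; rewrite /=; field.
rewrite (Rintegral_FTC _ dF); [|lra|exact: continuous_hat].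
rewrite /= hat_right// hat_left//; by field.
Qed.

(** [hat 1 e k / e ^+ 2] is an approximate identity at [k]. *)
Lemma hat_average (d : R -> R) e k (r : R) : 0 < r -> 0 < e -> continuous d ->
  (forall x, `|x - k| <= e -> `|d x - d k| <= r) ->
  `| \int[mu]_x (d x * hat 1 e k x) - e ^+ 2 * d k| <= r * e ^+ 2.
Proof.
move=> r0 e0 cd H.
have h0 x : x \notin `[k - e, k + e] -> hat 1 e k x = 0 by exact: hat1_out.
have ch := @continuous_hat 1 e k.
have ih : mu.-integrable setT (EFin \o hat 1 e k) by exact: integrable_cc ch h0.
have idh (g : R -> R) : continuous g ->
    mu.-integrable setT (EFin \o (fun x => g x * hat 1 e k x)).
  move=> cg; apply: (@integrable_cc _ _ (k - e) (k + e)).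
    by move=> x; apply: cvgM; [exact: cg|exact: ch].
  by move=> x /h0 ->; rewrite mulr0.
have cdk : continuous (fun x => d x - d k).
  by move=> x; apply: cvgB; [exact: cd|exact: cvg_cst].
have -> : \int[mu]_x (d x * hat 1 e k x) - e ^+ 2 * d k =
          \int[mu]_x ((d x - d k) * hat 1 e k x).
  under [RHS]eq_Rintegral do rewrite mulrBl.
  have cdk' := idh (cst (d k)) (fun x => cvg_cst _).
  rewrite RintegralB//; [|exact: idh|exact: cdk'].
  rewrite RintegralZl//.
  by rewrite Rintegral_hat1// (mulrC (d k)).
apply: le_trans (le_normr_Rintegral _ _) _ => //; first exact: idh.
rewrite -(@Rintegral_hat1 e k)// -RintegralZl//; apply: le_Rintegral => //.
- exact: (integrable_abse (idh _ cdk)).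
- exact: (integrableZl measurableT r ih).
move=> x _; rewrite normrM (ger0_norm (hat1_ge0 _ _ e0)).
have [xk|/h0 ->] := boolP (x \in `[k - e, k + e]); last by rewrite !mulr0.
apply: ler_wpM2r; first exact: hat1_ge0.
apply: H; move: xk; rewrite in_itv/= ler_distl; lra.
Qed.

Definition hat3 n e k1 k2 k3 w1 w2 w3 x : R :=
  w1 * hat n e k1 x + w2 * hat n e k2 x + w3 * hat n e k3 x.

Lemma is_derive_hat3 n e k1 k2 k3 w1 w2 w3 x :
  is_derive x 1 (hat3 n.+2 e k1 k2 k3 w1 w2 w3)
                (n.+2%:R * hat3 n.+1 e k1 k2 k3 w1 w2 w3 x).
Proof.
have D k := is_derive_hat n e k x.
have Z : is_derive x 1 (cst (0 : R)) (cst (0 : R) x) by exact: is_derive_cst.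
have H := @is_derive_lin _ _ _ _ w3 x (@is_derive_lin _ _ _ _ w2 x
  (@is_derive_lin _ _ _ _ w1 x Z (D k1)) (D k2)) (D k3).
rewrite (_ : hat3 _ _ _ _ _ _ _ _ = fun y => cst (0 : R) y + w1 * hat n.+2 e k1 y +
  w2 * hat n.+2 e k2 y + w3 * hat n.+2 e k3 y); last first.
  by apply/funext => y; rewrite /hat3 /= add0r.
by apply: is_derive_eq H _; rewrite /hat3/=; ring.
Qed.

Lemma continuous_hat3 n e k1 k2 k3 w1 w2 w3 :
  continuous (hat3 n e k1 k2 k3 w1 w2 w3).
Proof.
have C k : continuous (hat n e k) by exact: continuous_hat.
move=> x; apply: cvgD; first apply: cvgD.
all: by apply: cvgM; [exact: cvg_cst|exact: C].
Qed.

(** The two moment conditions say that the weights annihilate affine functions.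
    Together with the second difference inside [hat] they annihilate cubic
    polynomials, which is what [hat3] sees to the right of all its knots. *)
Lemma hat3_out n e k1 k2 k3 w1 w2 w3 A B x : 0 < e ->
  w1 + w2 + w3 = 0 -> w1 * k1 + w2 * k2 + w3 * k3 = 0 ->
  A <= k1 - e -> A <= k2 - e -> A <= k3 - e ->
  k1 + e <= B -> k2 + e <= B -> k3 + e <= B ->
  (n <= 2)%N -> x \notin `[A, B] -> hat3 n.+1 e k1 k2 k3 w1 w2 w3 x = 0.
Proof.
move=> e0 w0 wk A1 A2 A3 B1 B2 B3 n2.
rewrite in_itv/= negb_and -!ltNge => /orP[xA|xB].
  by rewrite /hat3 !hat_left//; [ring|lra..].
have w3E : w3 = - w1 - w2 by lra.
have wkE : w1 * k1 = - (w2 * k2 + w3 * k3) by lra.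
rewrite /hat3 !hat_right//; try lra.
move: n2; case: n => [|[|[|//]]] _.
- ring.
- rewrite (_ : _ + _ = (w1 + w2 + w3) * (2 * e ^+ 2)); last ring.
  by rewrite w0 mul0r.
- rewrite (_ : _ + _ = (w1 + w2 + w3) * (6 * e ^+ 2 * x) -
    6 * e ^+ 2 * (w1 * k1 + w2 * k2 + w3 * k3)); last ring.
  by rewrite w0 wk mul0r mulr0 subr0.
Qed.


Lemma continuous_modulus (d : R -> R) k (r : R) : continuous d -> 0 < r ->
  exists2 e, 0 < e & forall x, `|x - k| <= e -> `|d x - d k| <= r.
Proof.
move=> /(_ k) /cvgrPdist_le /(_ r) H /H /nbhs_ballP[e /= e0 He].
exists (e / 2) => [|x xk]; first exact: divr_gt0.
rewrite distrC; apply: He; rewrite /ball /= distrC (le_lt_trans xk)//.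
by rewrite ltr_pdivrMr// ltr_pMr// ltr1n.
Qed.

(** Distributional affinity implies affinity: for weights that annihilate affine
    functions the hypothesis applies, and letting the hats shrink turns the
    integral into the same combination of the values of [d].  The conclusion is
    the three-point form of the statement that [d] is affine on ]a, b[. *)
Lemma du_bois_reymond (d : R -> R) a b : continuous d ->
  (forall e k1 k2 k3 w1 w2 w3, 0 < e ->
     w1 + w2 + w3 = 0 -> w1 * k1 + w2 * k2 + w3 * k3 = 0 ->
     a < k1 - e -> a < k2 - e -> a < k3 - e ->
     k1 + e < b -> k2 + e < b -> k3 + e < b ->
     \int[mu]_x (d x * hat3 1 e k1 k2 k3 w1 w2 w3 x) = 0) ->
  {in `]a, b[ & &, forall k1 k2 k3,
    (k3 - k2) * d k1 + (k1 - k3) * d k2 + (k2 - k1) * d k3 = 0}.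
Proof.
move=> cd H k1 k2 k3; rewrite !in_itv/= => /andP[a1 b1] /andP[a2 b2] /andP[a3 b3].
set w1 := k3 - k2; set w2 := k1 - k3; set w3 := k2 - k1.
set S := _ + _.
have W0 : 0 <= `|w1| + `|w2| + `|w3| by rewrite !addr_ge0.
suff K (r : R) : 0 < r -> `|S| <= r * (`|w1| + `|w2| + `|w3|).
  apply/eqP; rewrite -normr_le0; apply/ler_addgt0Pl => z z0; rewrite addr0.
  have p : 0 < `|w1| + `|w2| + `|w3| + 1 by rewrite ltr_wpDl.
  apply: le_trans (K (z / (`|w1| + `|w2| + `|w3| + 1)) (divr_gt0 z0 p)) _.
  by rewrite mulrAC ler_pdivrMr// ler_pM2l// lerDl.
move=> r0; have [e1 e10 H1] := continuous_modulus k1 cd r0.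
have [e2 e20 H2] := continuous_modulus k2 cd r0.
have [e3 e30 H3] := continuous_modulus k3 cd r0.
near (0 : R)^'+ => e.
have e0 : 0 < e by near: e; exact: nbhs_right_gt.
have le1 : e <= e1 by near: e; exact: nbhs_right_le.
have le2 : e <= e2 by near: e; exact: nbhs_right_le.
have le3 : e <= e3 by near: e; exact: nbhs_right_le.
have m1 : a < k1 - e.
  by rewrite ltrBrDl -ltrBrDr; near: e; apply: nbhs_right_lt; rewrite subr_gt0.
have m2 : a < k2 - e.
  by rewrite ltrBrDl -ltrBrDr; near: e; apply: nbhs_right_lt; rewrite subr_gt0.
have m3 : a < k3 - e.
  by rewrite ltrBrDl -ltrBrDr; near: e; apply: nbhs_right_lt; rewrite subr_gt0.
have n1 : k1 + e < b.
  by rewrite -ltrBrDl; near: e; apply: nbhs_right_lt; rewrite subr_gt0.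
have n2 : k2 + e < b.
  by rewrite -ltrBrDl; near: e; apply: nbhs_right_lt; rewrite subr_gt0.
have n3 : k3 + e < b.
  by rewrite -ltrBrDl; near: e; apply: nbhs_right_lt; rewrite subr_gt0.
have w0 : w1 + w2 + w3 = 0 by rewrite /w1 /w2 /w3; ring.
have wk : w1 * k1 + w2 * k2 + w3 * k3 = 0 by rewrite /w1 /w2 /w3; ring.
have := H e k1 k2 k3 w1 w2 w3 e0 w0 wk m1 m2 m3 n1 n2 n3.
have ih k : a < k - e -> k + e < b ->
    mu.-integrable setT (EFin \o (fun x => d x * hat 1 e k x)).
  move=> ak kb; apply: (@integrable_cc _ _ (k - e) (k + e)).
    by move=> x; apply: cvgM; [exact: cd|exact: continuous_hat].
  by move=> x xk; rewrite hat1_out// mulr0.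
have -> : \int[mu]_x (d x * hat3 1 e k1 k2 k3 w1 w2 w3 x) =
  \int[mu]_x (w1 * (d x * hat 1 e k1 x) + w2 * (d x * hat 1 e k2 x)
    + w3 * (d x * hat 1 e k3 x)).
  by apply: eq_Rintegral => x _; rewrite /hat3; ring.
rewrite Rintegral_lin ?Rintegral_lin ?RintegralZl//; try exact: ih; last 2 first.
- exact: (integrableZl measurableT w1 (ih _ m1 n1)).
- apply: integrable_lin; last exact: ih.
  exact: (integrableZl measurableT w1 (ih _ m1 n1)).
have := hat_average r0 e0 cd (fun x xk => H1 x (le_trans xk le1)).
have := hat_average r0 e0 cd (fun x xk => H2 x (le_trans xk le2)).
have := hat_average r0 e0 cd (fun x xk => H3 x (le_trans xk le3)).
move: (\int[mu]_x (d x * hat 1 e k1 x)) (\int[mu]_x (d x * hat 1 e k2 x))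
   (\int[mu]_x (d x * hat 1 e k3 x)) => I1 I2 I3 h3 h2 h1 hI.
have e2p : 0 < e ^+ 2 by rewrite exprn_gt0.
rewrite -(ler_pM2l e2p).
have -> : e ^+ 2 * `|S| = `|w1 * (I1 - e ^+ 2 * d k1) + w2 * (I2 - e ^+ 2 * d k2)
    + w3 * (I3 - e ^+ 2 * d k3)|.
  rewrite -{1}(gtr0_norm e2p) -normrM -normrN; congr `|_|; rewrite /S.
  by rewrite -[LHS]add0r -hI; ring.
apply: le_trans (ler_normD _ _) _.
apply: le_trans (lerD (ler_normD _ _) (lexx _)) _.
rewrite !normrM.
have -> : e ^+ 2 * (r * (`|w1| + `|w2| + `|w3|)) =
  `|w1| * (r * e ^+ 2) + `|w2| * (r * e ^+ 2) + `|w3| * (r * e ^+ 2) by ring.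
by apply: lerD; [apply: lerD|]; apply: ler_wpM2l.
Unshelve. all: by end_near. Qed.

(** One more integration by parts moves the derivative away from
    [weak_deriv u], leaving only continuous integrands. *)
Lemma argmin_weak (V0 kappa alpha : R) (u : R -> R) a b (phi dphi ddphi : R -> R) A B :
  let c := kappa * cos alpha in let s := kappa * sin alpha in
  [set x | 0 < u x] = `]a, b[%classic -> is_argmin V0 kappa alpha a b u ->
  a < A -> A < B -> B < b ->
  (forall x, is_derive x 1 phi (dphi x)) ->
  (forall x, is_derive x 1 dphi (ddphi x)) -> continuous ddphi ->
  (forall x, x \notin `[A, B] -> phi x = 0) ->
  (forall x, x \notin `[A, B] -> dphi x = 0) ->
  \int[mu]_x phi x = 0 ->
  \int[mu]_x (c * (u x * phi x) - s * (phi x * x) - u x * ddphi x) = 0.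
Proof.
move=> c s upos umin aA AB Bb D1 D2 cdd phi0 dphi0 phiI.
have cd := is_derive_cont D2; have cp := is_derive_cont D1.
have := argmin_first_variation upos umin aA AB Bb D1 cd phi0 phiI.
rewrite -/c -/s => E; rewrite -[RHS]E.
have [[[Hu cu uout _] _ _] _] := umin.
have uout' x : x \notin `[a, b] -> u x = 0.
  by move=> xab; apply: uout; apply: contra xab; exact: subset_itv_oo_cc.
have Cd : C1c setT dphi by exact: C1cI D2 cdd dphi0 _.
have dE : derive1 dphi = ddphi by exact: is_derive_derive1.
have [lg] := weak_derivP Hu; move=> /(_ _ Cd); rewrite dE => G.
have [lu _] := Hu.
have [ld _] := C1c_Lfun2 Cd.
have i1 := Lfun2_mul_integrable lg ld.
have i2 : mu.-integrable setT (EFin \o (fun x => c * (u x * phi x) - s * (phi x * x))).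
  apply: (@integrable_cc _ _ A B) => [x|x xAB]; last by rewrite phi0//; ring.
  apply: cvgB; apply: cvgM; [exact: cvg_cst| |exact: cvg_cst|].
    by apply: cvgM; [exact: cu|exact: cp].
  by apply: cvgM; [exact: cp|exact: cvg_id].
have i3 : mu.-integrable setT (EFin \o (fun x => u x * ddphi x)).
  apply: (@integrable_cc _ _ a b) => [x|x xAB]; last by rewrite uout'//; ring.
  by apply: cvgM; [exact: cu|exact: cdd].
rewrite RintegralB// G opprK.
under [RHS]eq_Rintegral do rewrite -addrA.
by rewrite addrC -RintegralD.
Qed.

(** The weights 1, -2, 1 at equally spaced nodes give a cubic B-spline. *)
Lemma centered_hat3_out n e m A B x : 0 < e -> A <= m - 2 * e ->
  m + 2 * e <= B -> (n <= 2)%N -> x \notin `[A, B] ->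
  hat3 n.+1 e (m - e) m (m + e) 1 (-2) 1 x = 0.
Proof. by move=> e0 Am mB; apply: hat3_out => //; lra. Qed.

(** The integral of a cubic B-spline is a fourth difference of x^4 / 4. *)
Lemma Rintegral_centered_hat3 e m : 0 < e ->
  \int[mu]_x hat3 3 e (m - e) m (m + e) 1 (-2) 1 x = 6 * e ^+ 4.
Proof.
move=> e0; rewrite (@Rintegral_supp _ _ (m - 2 * e) (m + 2 * e)); last first.
  by move=> x; exact: centered_hat3_out.
have dF x : is_derive x 1
    (fun y => cst 0 y + 4^-1 * hat3 4 e (m - e) m (m + e) 1 (-2) 1 y)
    (hat3 3 e (m - e) m (m + e) 1 (-2) 1 x).
  have H := @is_derive_lin (cst 0) _ 0 _ 4^-1 x (is_derive_cst _ _ _)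
    (is_derive_hat3 2 e (m - e) m (m + e) 1 (-2) 1 x).
  by apply: is_derive_eq H _; rewrite /=; field.
rewrite (Rintegral_FTC _ dF); [|lra|exact: continuous_hat3].
have -> : hat3 4 e (m - e) m (m + e) 1 (-2) 1 (m - 2 * e) = 0.
  by rewrite /hat3 !hat_left; [ring|lra..].
have -> : hat3 4 e (m - e) m (m + e) 1 (-2) 1 (m + 2 * e) = 24 * e ^+ 4.
  by rewrite /hat3 !hat_right; [ring|lra..].
by rewrite /=; field.
Qed.

(** Subtracting a multiple of a fixed B-spline of nonzero integral turns any
    spline into one of zero mean, to which the first variation applies; the
    value of the functional on the B-spline yields the multiplier. *)
Lemma lagrange_multiplier (V0 kappa alpha : R) (u : R -> R) a b :
  let c := kappa * cos alpha in let s := kappa * sin alpha in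
  a < b ->
  [set x | 0 < u x] = `]a, b[%classic -> is_argmin V0 kappa alpha a b u ->
  exists lam : R, forall e k1 k2 k3 w1 w2 w3, 0 < e ->
     w1 + w2 + w3 = 0 -> w1 * k1 + w2 * k2 + w3 * k3 = 0 ->
     a < k1 - e -> a < k2 - e -> a < k3 - e ->
     k1 + e < b -> k2 + e < b -> k3 + e < b ->
     let phi := hat3 3 e k1 k2 k3 w1 w2 w3 in
     let ddphi x := 6 * hat3 1 e k1 k2 k3 w1 w2 w3 x in
  \int[mu]_x (c * (u x * phi x) - s * (phi x * x) - u x * ddphi x)
    = lam * \int[mu]_x phi x.
Proof.
move=> c s ab upos umin.
have [[[Hu cu uout _] _ _] _] := umin.
(* the reference B-spline occupies [m - 2 e', m + 2 e'], inside ]a, b[ *)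
pose m := (a + b) / 2; pose e' := (b - a) / 5.
have e'0 : 0 < e' by rewrite /e'; lra.
pose L (p p2 : R -> R) := \int[mu]_x (c * (u x * p x) - s * (p x * x) - u x * p2 x).
pose phi0 := hat3 3 e' (m - e') m (m + e') 1 (-2) 1.
pose ddphi0 x := 6 * hat3 1 e' (m - e') m (m + e') 1 (-2) 1 x.
have Iphi0 := Rintegral_centered_hat3 m e'0.
exists (L phi0 ddphi0 / (6 * e' ^+ 4)).
move=> e k1 k2 k3 w1 w2 w3 e0 w0 wk a1 a2 a3 b1 b2 b3 phi ddphi.
have D0 : 6 * e' ^+ 4 != 0 by rewrite mulf_neq0// expf_neq0// gt_eqF.
set t := \int[mu]_x phi x / (6 * e' ^+ 4).
rewrite -/(L phi ddphi) mulrAC -mulrA -/t.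
have me1 : a < m - 2 * e' by rewrite /m /e'; lra.
have me2 : m + 2 * e' < b by rewrite /m /e'; lra.
near a^'+ => A; near b^'- => B.
have aA : a < A by near: A; exact: nbhs_right_gt.
have Bb : B < b by near: B; exact: nbhs_left_lt.
have A1 : A <= k1 - e by near: A; exact: nbhs_right_le.
have A2 : A <= k2 - e by near: A; exact: nbhs_right_le.
have A3 : A <= k3 - e by near: A; exact: nbhs_right_le.
have A4 : A <= m - 2 * e' by near: A; exact: nbhs_right_le.
have B1 : k1 + e <= B by near: B; exact: nbhs_left_ge.
have B2 : k2 + e <= B by near: B; exact: nbhs_left_ge.
have B3 : k3 + e <= B by near: B; exact: nbhs_left_ge.
have B4 : m + 2 * e' <= B by near: B; exact: nbhs_left_ge.
have AB : A < B.
  apply: le_lt_trans A1 (lt_le_trans _ B1); rewrite ltrD2l; lra.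
pose dphi x := 3 * hat3 2 e k1 k2 k3 w1 w2 w3 x.
pose dphi0 x := 3 * hat3 2 e' (m - e') m (m + e') 1 (-2) 1 x.
have Z (f : R -> R) k (df : R) x :
    is_derive x 1 f df -> is_derive x 1 (fun y => k * f y) (k * df).
  by move=> Df; have := is_derive_lin k (is_derive_cst (0 : R) x 1) Df;
     rewrite add0r (_ : (fun _ => cst 0 _ + _) = fun y => k * f y)//;
     apply/funext => y; rewrite add0r.
have D1 x : is_derive x 1 phi (dphi x) by exact: is_derive_hat3.
have D2 x : is_derive x 1 dphi (ddphi x).
  have H := Z _ 3 _ _ (is_derive_hat3 0 e k1 k2 k3 w1 w2 w3 x).
  by apply: is_derive_eq H _; rewrite /ddphi; ring.
have D1' x : is_derive x 1 phi0 (dphi0 x) by exact: is_derive_hat3.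
have D2' x : is_derive x 1 dphi0 (ddphi0 x).
  have H := Z _ 3 _ _ (is_derive_hat3 0 e' (m - e') m (m + e') 1 (-2) 1 x).
  by apply: is_derive_eq H _; rewrite /ddphi0; ring.
have S n x : (n <= 2)%N -> x \notin `[A, B] -> hat3 n.+1 e k1 k2 k3 w1 w2 w3 x = 0.
  by move=> n2; apply: hat3_out.
have S' n x : (n <= 2)%N -> x \notin `[A, B] ->
    hat3 n.+1 e' (m - e') m (m + e') 1 (-2) 1 x = 0.
  exact: centered_hat3_out.
have cpsi : continuous phi := is_derive_cont D1.
have cphi0 : continuous phi0 := is_derive_cont D1'.
have cdd : continuous ddphi.
  by move=> x; apply: cvgM; [exact: cvg_cst|exact: continuous_hat3].
have cdd' : continuous ddphi0.
  by move=> x; apply: cvgM; [exact: cvg_cst|exact: continuous_hat3].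
have ip : mu.-integrable setT (EFin \o phi).
  by apply: (@integrable_cc _ _ A B) => // x; exact: S.
have ip' : mu.-integrable setT (EFin \o phi0).
  by apply: (@integrable_cc _ _ A B) => // x; exact: S'.
have := @argmin_weak V0 kappa alpha u a b (fun x => phi x + - t * phi0 x)
  (fun x => dphi x + - t * dphi0 x) (fun x => ddphi x + - t * ddphi0 x) A B upos umin aA AB Bb.
rewrite -/c -/s => /(_ (fun x => is_derive_lin (- t) (D1 x) (D1' x)))
  /(_ (fun x => is_derive_lin (- t) (D2 x) (D2' x))) /(_ (continuous_lin cdd cdd')).
have iL (p p2 : R -> R) : continuous p -> continuous p2 ->
    (forall x, x \notin `[A, B] -> p x = 0) ->
    (forall x, x \notin `[A, B] -> p2 x = 0) ->
    mu.-integrable setT (EFin \o (fun x => c * (u x * p x) - s * (p x * x) - u x * p2 x)).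
  move=> cp cp2 p0 p20; apply: (@integrable_cc _ _ A B) => [x|x xAB]; last first.
    by rewrite p0// p20//; ring.
  apply: cvgB; last by apply: cvgM; [exact: cu|exact: cp2].
  apply: cvgB; apply: cvgM; [exact: cvg_cst| |exact: cvg_cst|].
    by apply: cvgM; [exact: cu|exact: cp].
  by apply: cvgM; [exact: cp|exact: cvg_id].
have -> : \int[mu]_x (c * (u x * (phi x + - t * phi0 x)) - s * ((phi x + - t * phi0 x) * x)
    - u x * (ddphi x + - t * ddphi0 x)) = L phi ddphi + - t * L phi0 ddphi0.
  rewrite /L -Rintegral_lin.
  - by apply: eq_Rintegral => x _; ring.
  - apply: iL => // x xAB; [exact: S|by rewrite /ddphi S ?mulr0].
  - apply: iL => // x xAB; [exact: S'|by rewrite /ddphi0 S' ?mulr0].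
move=> E; apply/eqP; rewrite -subr_eq0 -mulrN [_ * - t]mulrC; apply/eqP/E.
- by move=> x xAB; rewrite /phi /phi0 S// S'//; ring.
- by move=> x xAB; rewrite /dphi /dphi0 S// S'//; ring.
- by rewrite Rintegral_lin// Iphi0 /t mulNr divfK// subrr.
Unshelve. all: by end_near. Qed.

End Spline.

(** * The equation of a minimizer and its slopes at the endpoints *)

Section Slopes.
Context {R : realType}.
Notation mu := (@lebesgue_measure R).
Implicit Types (f u : R -> R) (a b x k e : R).

Lemma eq_at_left_end (f g : R -> R) a b : a < b -> continuous f -> continuous g ->
  {in `]a, b[, f =1 g} -> f a = g a.
Proof.
move=> ab cf cg fg; apply/eqP; rewrite -subr_eq0; apply/eqP.
have H : (f x - g x) @[x --> a^'+] --> f a - g a.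
  by apply: cvgB; apply: cvg_at_right_filter; [exact: cf|exact: cg].
apply: (cvg_unique (@Rhausdorff R) H).
apply: cvg_near_cst; near=> x; apply/eqP; rewrite subr_eq0; apply/eqP; apply: fg.
by rewrite in_itv/=; apply/andP; split.
Unshelve. all: by end_near. Qed.

Lemma eq_at_right_end (f g : R -> R) a b : a < b -> continuous f -> continuous g ->
  {in `]a, b[, f =1 g} -> f b = g b.
Proof.
move=> ab cf cg fg; apply/eqP; rewrite -subr_eq0; apply/eqP.
have H : (f x - g x) @[x --> b^'-] --> f b - g b.
  by apply: cvgB; apply: cvg_at_left_filter; [exact: cf|exact: cg].
apply: (cvg_unique (@Rhausdorff R) H).
apply: cvg_near_cst; near=> x; apply/eqP; rewrite subr_eq0; apply/eqP; apply: fg.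
by rewrite in_itv/=; apply/andP; split.
Unshelve. all: by end_near. Qed.

(** [U] is a double antiderivative of the right-hand side, corrected by an affine
    function.  It is defined on the whole line, so that one-sided derivatives
    of [u] at the endpoints become ordinary derivatives of [U]. *)
Lemma argmin_ode (V0 kappa alpha : R) u a b :
  let c := kappa * cos alpha in let s := kappa * sin alpha in
  a < b ->
  [set x | 0 < u x] = `]a, b[%classic -> is_argmin V0 kappa alpha a b u ->
  exists (lam : R) (U U1 U2 : R -> R),
    [/\ forall x, is_derive x 1 U (U1 x), forall x, is_derive x 1 U1 (U2 x),
        continuous U2, {in `[a, b], U =1 u} &
        {in `[a, b], forall x, U2 x = c * u x - s * x - lam}].
Proof.
move=> c s ab upos umin.
have [[[Hu cu uout _] _ _] _] := umin.
have [lam Hlam] := lagrange_multiplier ab upos umin.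
(* a cutoff equal to 1 from a on and to 0 up to a - 1, so that the right-hand
     side has antiderivatives vanishing on the left *)
pose chi x := Num.min 1 (tpow 1 (x - (a - 1))).
pose f x := chi x * (c * u x - s * x - lam).
have chi1 x : a <= x -> chi x = 1.
  by move=> ax; rewrite /chi tpow_ge0E ?min_l//; lra.
have cchi : continuous chi.
  move=> x; have H : {for x, continuous ((fun=> 1) \min (fun y => tpow 1 (y - (a - 1))))}.
    apply: continuous_min; first exact: cst_continuous.
    exact: continuous_shift_tpow.
  exact: H.
have cf : continuous f.
  move=> x; apply: cvgM; first exact: cchi.
  apply: cvgB; last exact: cvg_cst.
  apply: cvgB; apply: cvgM; [exact: cvg_cst|exact: cu|exact: cvg_cst|exact: cvg_id].
have f0 x : x <= a - 1 -> f x = 0.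
  by move=> xa; rewrite /f /chi tpow_le0 ?subr_le0// min_r// mul0r.
have [F1 [dF1 F10]] := antiderivative cf f0.
have cF1 := is_derive_cont dF1.
have [F2 [dF2 _]] := antiderivative cF1 F10.
have cF2 := is_derive_cont dF2.
pose d x := u x - F2 x.
have cd : continuous d by move=> x; apply: cvgB; [exact: cu|exact: cF2].
have aff : {in `]a, b[ & &, forall k1 k2 k3,
    (k3 - k2) * d k1 + (k1 - k3) * d k2 + (k2 - k1) * d k3 = 0}.
  apply: du_bois_reymond => // e k1 k2 k3 w1 w2 w3 e0 w0 wk a1 a2 a3 b1 b2 b3.
  have := Hlam e k1 k2 k3 w1 w2 w3 e0 w0 wk a1 a2 a3 b1 b2 b3.
  rewrite /= -/c -/s.
  set h3 := hat3 3 e k1 k2 k3 w1 w2 w3; set h2 := hat3 2 e k1 k2 k3 w1 w2 w3.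
  set h1 := hat3 1 e k1 k2 k3 w1 w2 w3 => E.
  have D3 x : is_derive x 1 h3 (3 * h2 x) by exact: is_derive_hat3.
  have D2 x : is_derive x 1 h2 (2 * h1 x) by exact: is_derive_hat3.
  have S n x : (n <= 2)%N -> x \notin `[a, b] -> hat3 n.+1 e k1 k2 k3 w1 w2 w3 x = 0.
    by move=> n2; apply: hat3_out => //; exact: ltW.
  have c1 : continuous h1 by exact: continuous_hat3.
  have c2 : continuous h2 by exact: continuous_hat3.
  have c3 : continuous h3 by exact: continuous_hat3.
  have cM k (h : R -> R) : continuous h -> continuous (fun x => k * h x).
    by move=> ch x; apply: cvgM; [exact: cvg_cst|exact: ch].
  have I (g h : R -> R) : continuous g -> continuous h ->
      (forall x, x \notin `[a, b] -> h x = 0) ->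
      mu.-integrable setT (EFin \o (fun x => g x * h x)).
    move=> cg ch h0; apply: (@integrable_cc _ _ a b) => [x|x /h0 ->]; last by rewrite mulr0.
    by apply: cvgM; [exact: cg|exact: ch].
  have S1 x : x \notin `[a, b] -> h1 x = 0 by exact: S.
  have S2 x : x \notin `[a, b] -> h2 x = 0 by exact: S.
  have S3 x : x \notin `[a, b] -> h3 x = 0 by exact: S.
  have P1 : \int[mu]_x (F2 x * (2 * h1 x)) = - \int[mu]_x (F1 x * h2 x).
    apply: (Rint_by_parts dF2 cF1 D2 (cM _ _ c1) S2).
    by move=> x /S1 ->; rewrite mulr0.
  have P2 : \int[mu]_x (F1 x * (3 * h2 x)) = - \int[mu]_x (f x * h3 x).
    apply: (Rint_by_parts dF1 cf D3 (cM _ _ c2) S3).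
    by move=> x /S2 ->; rewrite mulr0.
  have P1' : 2 * \int[mu]_x (F2 x * h1 x) = - \int[mu]_x (F1 x * h2 x).
    rewrite -P1 -RintegralZl//; last exact: I.
    by apply: eq_Rintegral => x _; ring.
  have P2' : 3 * \int[mu]_x (F1 x * h2 x) = - \int[mu]_x (f x * h3 x).
    rewrite -P2 -RintegralZl//; last exact: I.
    by apply: eq_Rintegral => x _; ring.
  have E' : \int[mu]_x (f x * h3 x) = 6 * \int[mu]_x (u x * h1 x).
    have -> : \int[mu]_x (f x * h3 x) = \int[mu]_x ((c * (u x * h3 x) - s * (h3 x * x)
        - u x * (6 * h1 x)) + 6 * (u x * h1 x) + (- lam) * h3 x).
      apply: eq_Rintegral => x _.
      have [xab|/S3 ->] := boolP (x \in `[a, b]); last first.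
        by ring.
      rewrite /f chi1; last by move: xab; rewrite in_itv/= => /andP[].
      by ring.
    have i0 : mu.-integrable setT (EFin \o (fun x => c * (u x * h3 x) - s * (h3 x * x)
        - u x * (6 * h1 x))).
      apply: (@integrable_cc _ _ a b) => [x|x xab]; last by rewrite S3// S1//; ring.
      apply: cvgB; last by apply: cvgM; [exact: cu|exact: cM].
      apply: cvgB; apply: cvgM; [exact: cvg_cst| |exact: cvg_cst|].
        by apply: cvgM; [exact: cu|exact: c3].
      by apply: cvgM; [exact: c3|exact: cvg_id].
    rewrite Rintegral_lin; [|apply: integrable_lin => //; exact: I|].
      rewrite Rintegral_lin//; last exact: I.
      by rewrite E; ring.
    exact: (@integrable_cc _ _ a b).
  have -> : \int[mu]_x (d x * h1 x) =
      \int[mu]_x (u x * h1 x) + (-1) * \int[mu]_x (F2 x * h1 x).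
    rewrite -Rintegral_lin; [|exact: I..].
    by apply: eq_Rintegral => x _; rewrite /d; ring.
  lra.
(* the affine function that agrees with d at m1 and m2 *)
pose m1 := (2 * a + b) / 3; pose m2 := (a + 2 * b) / 3.
have m12 : 0 < m2 - m1 by rewrite /m1 /m2; lra.
pose sg := (d m2 - d m1) / (m2 - m1).
pose U x := F2 x + (d m1 - sg * m1 + sg * x).
have dU x : is_derive x 1 U (F1 x + sg).
  have Dl : is_derive x 1 (fun y => (d m1 - sg * m1) + sg * y) (0 + sg * 1).
    exact: (is_derive_lin sg (is_derive_cst _ x 1) (is_derive_id x 1)).
  have D := is_deriveD (dF2 x) Dl.
  by apply: is_derive_eq D _; rewrite add0r mulr1.
have dU1 x : is_derive x 1 (fun y => F1 y + sg) (f x).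
  have D := is_deriveD (dF1 x) (is_derive_cst sg x 1).
  by apply: is_derive_eq D _; rewrite addr0.
have cU := is_derive_cont dU.
have Uu : {in `]a, b[, U =1 u}.
  move=> x xab; have := aff m1 m2 x.
  rewrite !in_itv/= => /(_ _ _ xab) H.
  have {}H : (x - m2) * d m1 + (m1 - x) * d m2 + (m2 - m1) * d x = 0.
    by apply: H; rewrite /m1 /m2; lra.
  apply/eqP; rewrite -subr_eq0 -(mulrI_eq0 _ (lregP (lt0r_neq0 m12))) -oppr_eq0 -H.
  by rewrite /U /sg /d; apply/eqP; field; rewrite gt_eqF.
exists lam, U, (fun x => F1 x + sg), f; split => //.
- move=> x; rewrite in_itv/= => /andP[]; rewrite le_eqVlt => /predU1P[<- _|ax].
    exact: eq_at_left_end ab cU cu Uu.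
  rewrite le_eqVlt => /predU1P[->|xb]; first exact: eq_at_right_end ab cU cu Uu.
  by apply: Uu; rewrite in_itv/= ax.
- by move=> x; rewrite in_itv/= => /andP[ax _]; rewrite /f chi1// mul1r.
Qed.

(** This is y / 2 * coth (y / 2) - 1. *)
Definition xcoth_sub1 (y : R) : R := y / 2 * ((expR y + 1) / (expR y - 1)) - 1.

Lemma is_derive_const (H H' : R -> R) a b : a < b ->
  (forall x, is_derive x 1 H (H' x)) -> {in `]a, b[, forall x, H' x = 0} ->
  H a = H b.
Proof.
move=> ab dH H0; have [x xab] := MVT ab (fun x _ => dH x)
  (continuous_subspaceT (is_derive_cont dH)).
by rewrite H0// mul0r => /eqP; rewrite subr_eq0 => /eqP.
Qed.

(** For a solution W of W'' = c W and k^2 = c, the quantity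
    exp (k x) (W' - k W) is constant.  This is used for both square roots of c
    and for W = U - (s x + lam) / c, and combined with the integral of the
    equation over [a, b], which brings in the volume. *)
Lemma ode_slopes (c s lam V0 : R) u (U U1 U2 : R -> R) a b :
  0 < c -> a < b ->
  (forall x, is_derive x 1 U (U1 x)) -> (forall x, is_derive x 1 U1 (U2 x)) ->
  continuous U2 -> {in `[a, b], U =1 u} ->
  {in `[a, b], forall x, U2 x = c * u x - s * x - lam} ->
  u a = 0 -> u b = 0 -> continuous u -> \int[mu]_(x in `[a, b]) u x = V0 ->
  let G := xcoth_sub1 (Num.sqrt c * (b - a)) in
  U1 a + U1 b = - 2 * (s / c) * G /\ (U1 a - U1 b) * G = c * V0.
Proof.
move=> c0 ab dU dU1 cU2 Uu U2E ua ub cu uV G.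
pose w := Num.sqrt c.
have w0 : 0 < w by rewrite sqrtr_gt0.
have ww : w ^+ 2 = c by rewrite sqr_sqrtr// ltW.
pose W x := U x - (s * x + lam) / c; pose W1 x := U1 x - s / c.
have dW x : is_derive x 1 W (W1 x).
  have D := is_derive_lin (- c^-1) (dU x)
     (is_derive_lin s (is_derive_cst lam x 1) (is_derive_id x 1)).
  rewrite (_ : W = fun y => U y + - c^-1 * (cst lam y + s * id y)); last first.
    by apply/funext => y; rewrite /W /=; ring.
  by apply: is_derive_eq D _; rewrite /W1; ring.
have dW1 x : is_derive x 1 W1 (U2 x).
  have D := is_deriveB (dU1 x) (is_derive_cst (s / c) x 1).
  by apply: is_derive_eq D _; rewrite subr0.
have W2 : {in `]a, b[, forall x, U2 x = c * W x}.
  move=> x xab; have xab' : x \in `[a, b] by exact: subset_itv_oo_cc.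
  by rewrite U2E// /W Uu//; field; rewrite gt_eqF.
have dexp k x : is_derive x 1 (fun y => expR (k * y)) (k * expR (k * x)).
  have D0 := @is_deriveZ R R R id k x 1 1 (is_derive_id x 1).
  have D := @is_derive1_comp R expR (fun y => k * y) x _ _ (is_derive_expR _) D0.
  by apply: is_derive_eq D _; rewrite /GRing.scale/= mulr1 mulrC.
have H k : k ^+ 2 = c ->
    expR (k * a) * (W1 a - k * W a) = expR (k * b) * (W1 b - k * W b).
  move=> kk.
  have D x := is_deriveM (dexp k x) (is_derive_lin (- k) (dW1 x) (dW x)).
  have H0 := is_derive_const ab D.
  have -> z : W1 z - k * W z = W1 z + - k * W z by ring.
  have -> z : W1 z - k * W z = W1 z + - k * W z by ring.
  apply: H0 => x xab; rewrite /GRing.scale/= W2// -kk; ring.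
have H1 := H w ww.
have H2 : expR (- w * a) * (W1 a - - w * W a) = expR (- w * b) * (W1 b - - w * W b).
  by apply: H; rewrite sqrrN.
pose E := expR (w * (b - a)).
have E1 : 1 < E by rewrite expR_gt1 mulr_gt0// subr_gt0.
have e1 : W1 a - w * W a = E * (W1 b - w * W b).
  have := congr1 (fun z => expR (- w * a) * z) H1.
  rewrite /= !mulrA -!expRD mulNr addNr expR0 mul1r => ->.
  by rewrite /E; congr (expR _ * _); ring.
have e2 : E * (W1 a + w * W a) = W1 b + w * W b.
  have := congr1 (fun z => expR (w * b) * z) H2.
  rewrite /= !mulrA -!expRD (_ : w * b + - w * b = 0); last ring.
  rewrite expR0 mul1r !mulNr !opprK => <-.
  by rewrite /E; congr (expR _ * _); ring.
have V : c * V0 = U1 b - U1 a + s * (b ^+ 2 - a ^+ 2) / 2 + lam * (b - a).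
  have dP x : is_derive x 1 (fun y => U1 y + (2^-1 * s) * (y * y) + lam * y)
      (U2 x + s * x + lam).
    have D2 := is_deriveM (is_derive_id x (1 : R)) (is_derive_id x 1).
    have D := is_derive_lin lam (is_derive_lin (2^-1 * s) (dU1 x) D2) (is_derive_id x 1).
    by apply: is_derive_eq D _; rewrite /GRing.scale/=; field.
  have ci : continuous (fun x => U2 x + s * x + lam).
    move=> x; apply: cvgD; last exact: cvg_cst.
    by apply: cvgD; [exact: cU2|apply: cvgM; [exact: cvg_cst|exact: cvg_id]].
  have := Rintegral_FTC ab dP ci.
  have -> : \int[mu]_(x in `[a, b]) (U2 x + s * x + lam) = \int[mu]_(x in `[a, b]) (c * u x).
    by apply: eq_Rintegral => x; rewrite inE => xab; rewrite U2E//; ring.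
  rewrite RintegralZl//; last first.
    apply: continuous_compact_integrable; first exact: segment_compact.
    exact: continuous_subspaceT.
  by rewrite uV => ->; field.
have Wa : W a = - (s * a + lam) / c.
  by rewrite /W Uu ?ua ?in_itv/= ?lexx ?ltW// sub0r mulNr.
have Wb : W b = - (s * b + lam) / c.
  by rewrite /W Uu ?ub ?in_itv/= ?lexx ?ltW// sub0r mulNr.
have cn0 : c != 0 by rewrite gt_eqF.
have En0 : E - 1 != 0 by rewrite gt_eqF// subr_gt0.
rewrite /G /xcoth_sub1 -/w -/E.
move: e1 e2; rewrite Wa Wb /W1; move: (U1 a) (U1 b) V => p q V e1 e2.
have c1 : (E - 1) * (p + q - 2 * (s / c)) = - ((E + 1) * (w * (s / c) * (b - a))).
  have : (E - 1) * (p + q - 2 * (s / c)) + (E + 1) * (w * (s / c) * (b - a)) =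
   (E * (q - s / c - w * (- (s * b + lam) / c)) - (p - s / c - w * (- (s * a + lam) / c))) +
   (E * (p - s / c + w * (- (s * a + lam) / c)) - (q - s / c + w * (- (s * b + lam) / c))).
    by field.
  by rewrite -e1 e2; lra.
have c2 : (E + 1) * (p - q) = (E - 1) * w * (s * (a + b) + 2 * lam) / c.
  have : (E + 1) * (p - q) - (E - 1) * w * (s * (a + b) + 2 * lam) / c =
   - (E * (q - s / c - w * (- (s * b + lam) / c)) - (p - s / c - w * (- (s * a + lam) / c))) +
   (E * (p - s / c + w * (- (s * a + lam) / c)) - (q - s / c + w * (- (s * b + lam) / c))).
    by field.
  by rewrite -e1 e2; lra.
split.
  apply: (mulfI En0).
  have -> : (E - 1) * (p + q) =
    (E - 1) * (p + q - 2 * (s / c)) + (E - 1) * 2 * (s / c) by ring.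
  by rewrite c1; field; rewrite En0 cn0.
have V' : c * V0 + p - q = (s * (a + b) + 2 * lam) * (b - a) / 2 by rewrite V; field.
apply: (mulfI En0).
have -> : (E - 1) * ((p - q) * (w * (b - a) / 2 * ((E + 1) / (E - 1)) - 1)) =
  w * (b - a) / 2 * ((E + 1) * (p - q)) - (E - 1) * (p - q) by field.
rewrite c2.
have -> : w * (b - a) / 2 * ((E - 1) * w * (s * (a + b) + 2 * lam) / c) =
  (w ^+ 2 / c) * (E - 1) * ((s * (a + b) + 2 * lam) * (b - a) / 2) by field.
by rewrite -V' ww divff//; ring.
Qed.

End Slopes.

(** * Gronwall's lemma for one-sided derivatives known almost everywhere *)

Section Dini.
Context {R : realType}.
Notation mu := (@lebesgue_measure R).
Implicit Types (F G : R -> R) (s t h e K C L T : R).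

(** The upper right Dini derivative of [F] at [t] is at most [L]. *)
Definition right_dini_le F t L : Prop :=
  forall e, 0 < e -> \forall h \near 0^'+, F (t + h) <= F t + h * (L + e).

(** Stated for ordered times in [0, T], which spares absolute values of time
    differences. *)
Definition lip_upto F C T : Prop :=
  forall s t, 0 <= s -> s <= t -> t <= T -> `|F t - F s| <= C * (t - s).

Section Cover.
Variables (O : set R) (oO : open O) (eta : R) (O_lt : (mu O < eta%:E)%E).

Let mO : measurable O. Proof. exact: open_measurable. Qed.

(** The measure of the part of [O] met before time [t].  It grows at unit speed
    inside [O], which lets it absorb the variation of a Lipschitz function
    there, while its total growth is less than [eta]. *)
Definition covered t : R := fine (mu (O `&` `[0, t]%classic)).

Let mOt t : measurable (O `&` `[0, t]%classic).
Proof. exact: measurableI. Qed.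

Let fin_sub (A : set R) : measurable A -> A `<=` O -> mu A \is a fin_num.
Proof.
move=> mA AO; rewrite ge0_fin_numE//.
have AO' : (mu A <= mu O)%E by apply: le_measure; rewrite ?inE.
by apply: le_lt_trans AO' (lt_trans O_lt (ltry _)).
Qed.

Lemma covered_ge0 t : 0 <= covered t.
Proof. by rewrite fine_ge0. Qed.

Lemma covered_lt t : covered t < eta.
Proof.
rewrite -lte_fin fineK; last exact: fin_sub.
apply: le_lt_trans O_lt.
by apply: le_measure; rewrite ?inE; [exact: mOt|exact: mO|exact: subIsetl].
Qed.

Lemma coveredD s t : 0 <= s -> s <= t ->
  covered t = covered s + fine (mu (O `&` `]s, t]%classic)).
Proof.
move=> s0 st; have mst : measurable (O `&` `]s, t]%classic) by exact: measurableI.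
rewrite /covered -fineD; [|exact: fin_sub..].
congr fine.
have -> : O `&` `[0, t]%classic = (O `&` `[0, s]%classic) `|` (O `&` `]s, t]%classic).
  rewrite -setIUr; congr (_ `&` _); apply/seteqP; split=> x /=; rewrite !in_itv/=.
    by have [xs|xs] := leP x s; [move=> /andP[-> _]; left|move=> /andP[_ ->]; right].
  by case=> /andP[]; lra.
rewrite measureU//; first exact: mOt.
apply/seteqP; split=> x //= [[_ +] [_]]; rewrite !in_itv/=; lra.
Qed.

Lemma covered_itv s t : s <= t -> fine (mu `]s, t]%classic) = t - s.
Proof.
move=> st; rewrite lebesgue_measure_itv/= lte_fin.
by move: st; rewrite le_eqVlt => /predU1P[->|->]//; rewrite ltxx subrr.
Qed.

Lemma covered_incr s t : 0 <= s -> s <= t ->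
  covered s <= covered t <= covered s + (t - s).
Proof.
move=> s0 st; rewrite (coveredD s0 st) lerDl fine_ge0//= lerD2l -(covered_itv st).
have mst : measurable (O `&` `]s, t]%classic) by exact: measurableI.
apply: fine_le; first exact: fin_sub.
  by rewrite ge0_fin_numE// lebesgue_measure_itv/=; case: ifP => _; rewrite ?ltry.
by apply: le_measure; rewrite ?inE//.
Qed.

Lemma covered_itv_sub s t : 0 <= s -> s <= t -> `]s, t]%classic `<=` O ->
  covered t = covered s + (t - s).
Proof.
move=> s0 st stO; rewrite (coveredD s0 st) -(covered_itv st).
by congr (_ + fine (mu _)); apply/setIidPr.
Qed.

(** [Psi] = [G] - 2 C covered - 2 eta t decreases to the right of a time [t] in [O]
    because the term in [covered] beats the Lipschitz constant, and to the
    right of a time outside [O] with [G t >= 0] because of the term in [eta].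
    Applied at the last time when [Psi <= 0], this shows that [Psi] never
    becomes positive. *)
Lemma dini_le0_cover G C T : 0 <= C -> 0 < eta -> 0 <= T -> O 0 -> lip_upto G C T ->
  (forall t, 0 < t -> ~ O t -> 0 <= G t -> right_dini_le G t 0) ->
  G 0 <= 0 -> G T <= 2 * C * eta + 2 * eta * T.
Proof.
move=> C0 eta0 T0 O0 lG dG G0.
pose Psi t := G t - 2 * C * covered t - 2 * eta * t.
suff : Psi T <= 0.
  have := ltW (covered_lt T); rewrite /Psi => cT; nra.
rewrite leNgt; apply/negP => PT.
(* a Lipschitz constant of Psi *)
pose C' := 3 * C + 2 * eta.
have C'0 : 0 < C' by rewrite /C'; nra.
have lP s t : 0 <= s -> s <= t -> t <= T -> `|Psi t - Psi s| <= C' * (t - s).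
  move=> s0 st tT; have := lG s t s0 st tT; have /andP[] := covered_incr s0 st.
  rewrite /Psi /C'; move: (covered t) (covered s) => x y xy1 xy2.
  by rewrite !ler_norml => /andP[? ?]; apply/andP; split; nra.
pose S := [set t | 0 <= t <= T /\ Psi t <= 0].
have S0 : S 0.
  split; first by rewrite lexx.
  by rewrite /Psi; have := covered_ge0 0; nra.
have hS : has_sup S.
  by split; [exists 0|exists T => x [/andP[]]].
pose t0 := sup S.
have t00 : 0 <= t0 by apply: ub_le_sup => //; case: hS.
have t0T : t0 <= T by apply: ge_sup => [|x [/andP[]]]//; exists 0.
have Pt0 : Psi t0 <= 0.
  apply/ler_addgt0Pl => e e0; rewrite addr0.
  have [x Sx xt] := sup_adherent (divr_gt0 e0 C'0) hS.
  have xt0 : x <= t0 by apply: ub_le_sup => //; case: hS.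
  case: Sx => /andP[x0 xT] Px.
  have := lP x t0 x0 xt0 t0T; rewrite ler_norml => /andP[_].
  have : C' * (t0 - x) <= e.
    by rewrite mulrC -ler_pdivlMr// lerBlDl -lerBlDr ltW.
  lra.
have t0ltT : t0 < T.
  by rewrite lt_neqAle t0T andbT; apply: contraTneq PT => <-; rewrite -leNgt.
have Ppos t : t0 < t -> t <= T -> 0 < Psi t.
  move=> t0t tT; rewrite ltNge; apply/negP => Pt.
  suff : t <= t0 by rewrite leNgt t0t.
  apply: ub_le_sup; first by case: hS.
  by split=> //; rewrite tT andbT (le_trans t00)// ltW.
have Gt0 : 0 <= G t0.
  suff : 0 <= Psi t0 by rewrite /Psi; have := covered_ge0 t0; nra.
  apply/ler_addgt0Pl => e e0.
  pose t := Num.min T (t0 + e / C').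
  have ht : t0 < t by rewrite lt_min t0ltT/= ltrDl divr_gt0.
  have tT : t <= T by rewrite ge_min lexx.
  have := lP t0 t t00 (ltW ht) tT; rewrite ler_norml => /andP[_].
  have := Ppos t ht tT.
  have : C' * (t - t0) <= e.
    by rewrite mulrC -ler_pdivlMr// lerBlDl ge_min lexx orbT.
  lra.
(* both cases contradict the positivity of Psi just after t0 *)
have [Ot0|nOt0] := pselect (O t0).
  have /nbhs_ballP[r /= r0 rO] : nbhs t0 O by apply: open_nbhs_nbhs.
  pose t := Num.min T (t0 + r / 2).
  have ht : t0 < t by rewrite lt_min t0ltT/= ltrDl divr_gt0.
  have tT : t <= T by rewrite ge_min lexx.
  have tr : t <= t0 + r / 2 by rewrite ge_min lexx orbT.
  have sub : `]t0, t]%classic `<=` O.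
    move=> x /=; rewrite in_itv/= => /andP[t0x xt]; apply: rO.
    rewrite /ball /= ltr_distl; lra.
  have := Ppos t ht tT.
  have := lG t0 t t00 (ltW ht) tT; rewrite ler_norml => /andP[_].
  move: Pt0; rewrite /Psi (covered_itv_sub t00 (ltW ht) sub).
  nra.
have t0p : 0 < t0.
  by rewrite lt_neqAle t00 andbT; apply: contra_notN nOt0 => /eqP <-.
have dn := dG t0 t0p nOt0 Gt0 eta eta0.
have [h [h0 hT Dh]] : exists h, [/\ 0 < h, t0 + h <= T & G (t0 + h) <= G t0 + h * (0 + eta)].
  near (0 : R)^'+ => h; exists h; split; near: h.
  - exact: nbhs_right_gt.
  - have : \forall h \near (0:R)^'+, h <= T - t0 by apply: nbhs_right_le; rewrite subr_gt0.
    by apply: filterS => h; rewrite lerBrDl.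
  - exact: dn.
have := Ppos (t0 + h); rewrite ltrDl => /(_ h0 hT).
have th : t0 <= t0 + h by rewrite lerDl ltW.
have /andP[+ _] := covered_incr t00 th.
move: Pt0 Dh; rewrite /Psi add0r; nra.
Unshelve. all: by end_near. Qed.

End Cover.

(** The exceptional times, and time 0, are covered by open sets of arbitrarily
    small measure. *)
Lemma dini_le0 G C T : 0 <= C -> 0 <= T -> lip_upto G C T ->
  {ae mu, forall t, 0 < t -> 0 <= G t -> right_dini_le G t 0} ->
  G 0 <= 0 -> G T <= 0.
Proof.
move=> C0 T0 lG [N [mN N0 HN]] G0.
pose N' : set R := N `|` [set 0%R].
have mN' : measurable N' by apply: measurableU.
have N'0 : (mu N' = 0)%E.
  by apply: null_set_setU => //; exact: lebesgue_measure_set1.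
have K (eta : R) : 0 < eta -> G T <= 2 * C * eta + 2 * eta * T.
  have muN' : (mu N' < +oo)%E by rewrite N'0 ltry.
  move=> eta0; have [U [oU NU UN]] := lebesgue_regularity_outer mN' muN' eta0.
  have Ueta : (mu U < eta%:E)%E.
    rewrite (_ : U = (U `\` N') `|` N'); last first.
      by rewrite setUC setDUK.
    apply: le_lt_trans UN.
    have mUN : measurable (U `\` N').
      by apply: measurableD => //; exact: open_measurable.
    have H : (mu ((U `\` N') `|` N') <= mu (U `\` N') + mu N')%E by exact: measureU2.
    by move: H; rewrite N'0 adde0.
  apply: (dini_le0_cover oU Ueta C0 eta0 T0 _ lG _ G0); first by apply: NU; right.
  move=> t t0 nUt; have [//|nH] := pselect (0 <= G t -> right_dini_le G t 0).
  exfalso; apply: nUt; apply: NU; left; apply: HN => /= H; exact/nH/H.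
apply/ler_addgt0Pl => e e0; rewrite addr0.
have p : 0 < 2 * C + 2 * T + 1 by nra.
apply: le_trans (K (e / (2 * C + 2 * T + 1)) (divr_gt0 e0 p)) _.
have -> : 2 * C * (e / (2 * C + 2 * T + 1)) + 2 * (e / (2 * C + 2 * T + 1)) * T =
   e * ((2 * C + 2 * T) / (2 * C + 2 * T + 1)) by field; rewrite gt_eqF.
by rewrite ler_piMr ?(ltW e0)// ler_pdivrMr// mul1r lerDl.
Qed.

Lemma expRN_lip K s t : 0 <= K -> 0 <= s -> s <= t ->
  `|expR (- K * t) - expR (- K * s)| <= K * (t - s).
Proof.
move=> K0 s0 st; rewrite ler0_norm; last first.
  by rewrite subr_le0 ler_expR; nra.
have -> : - K * t = - K * s + - K * (t - s) by ring.
rewrite expRD opprB.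
have e1 : expR (- K * s) <= 1 by rewrite -expR0 ler_expR; nra.
have e0 := expR_gt0 (- K * s).
have := expR_ge1Dx (- K * (t - s)).
have Kd : 0 <= K * (t - s) by rewrite mulr_ge0// subr_ge0.
have -> : expR (- K * s) - expR (- K * s) * expR (- K * (t - s)) =
  expR (- K * s) * (1 - expR (- K * (t - s))) by ring.
move=> eb.
apply: (@le_trans _ _ (expR (- K * s) * (K * (t - s)))).
  by rewrite ler_pM2l//; lra.
by rewrite ler_piMl.
Qed.

(** The factor exp (- K t) turns the bound K F into the bound 0. *)
Lemma gronwall_le0 F C K : 0 <= C -> 0 <= K -> (forall T, lip_upto F C T) ->
  {ae mu, forall t, 0 < t -> 0 <= F t -> right_dini_le F t (K * F t)} ->
  F 0 <= 0 -> forall T, 0 <= T -> F T <= 0.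
Proof.
move=> C0 K0 lF dF F0 T T0.
pose G t := expR (- K * t) * F t.
suff : G T <= 0 by rewrite /G pmulr_rle0// expR_gt0.
pose B := `|F 0| + C * T.
have B0 : 0 <= B by rewrite addr_ge0// mulr_ge0.
have FB t : 0 <= t -> t <= T -> `|F t| <= B.
  move=> t0 tT; have := lF T 0 t (lexx _) t0 tT.
  rewrite subr0 => H; rewrite -[F t](subrK (F 0)).
  apply: le_trans (ler_normD _ _) _; rewrite /B addrC lerD2l.
  by apply: le_trans H _; rewrite ler_wpM2l.
apply: (@dini_le0 G (C + B * K)) => //.
- by rewrite addr_ge0// mulr_ge0.
- move=> s t s0 st tT.
  have -> : G t - G s = expR (- K * t) * (F t - F s) +
     (expR (- K * t) - expR (- K * s)) * F s by rewrite /G; ring.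
  apply: le_trans (ler_normD _ _) _; rewrite !normrM mulrDl.
  have t0 := le_trans s0 st.
  apply: lerD.
    have e1 : `|expR (- K * t)| <= 1.
      by rewrite ger0_norm ?expR_ge0// -expR0 ler_expR; nra.
    by apply: le_trans (lF T s t s0 st tT); rewrite ler_piMl.
  rewrite mulrC -mulrA; apply: ler_pM => //; last exact: expRN_lip.
  by apply: FB => //; exact: le_trans tT.
- apply: filterS dF; first exact: (ae_filter_ringOfSetsType mu).
  move=> t H t0; rewrite /G pmulr_rge0 ?expR_gt0// => Ft e e0.
  have p : 0 < e / expR (- K * t) by rewrite divr_gt0// expR_gt0.
  near=> h.
  have h0 : 0 < h by near: h; exact: nbhs_right_gt.
  have Fh : F (t + h) <= F t + h * (K * F t + e / expR (- K * t)).
    by near: h; exact: H.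
  rewrite mulrDr expRD.
  have E0 := expR_gt0 (- K * t).
  have Eh0 := expR_gt0 (- K * h).
  have Eh1 : expR (- K * h) <= 1 by rewrite -expR0 ler_expR; nra.
  have Eh : expR (- K * h) * (1 + K * h) <= 1.
    have := expR_ge1Dx (K * h); rewrite -(ler_pM2l Eh0) -expRD mulNr addNr expR0//.
  apply: (@le_trans _ _ (expR (- K * t) * expR (- K * h) *
      (F t + h * (K * F t + e / expR (- K * t))))).
    by rewrite ler_wpM2l// mulr_ge0// ltW.
  have -> : expR (- K * t) * expR (- K * h) * (F t + h * (K * F t + e / expR (- K * t))) =
    expR (- K * t) * F t * (expR (- K * h) * (1 + K * h)) + expR (- K * h) * (h * e).
    by field; rewrite gt_eqF.
  rewrite add0r; apply: lerD.
    by rewrite ler_piMr// mulr_ge0// ltW.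
  by rewrite ler_piMl// mulr_ge0// ltW.
- by rewrite /G pmulr_rle0// expR_gt0.
Unshelve. all: by end_near. Qed.

(** By [gronwall_le0] the function is already nonpositive.  Adding the solution
    - F 0 exp (- K t) of y' = - K y gives a function that starts at 0 and whose
    Dini derivative is nonpositive wherever it is nonnegative, since there
    |F t| <= y t. *)
Lemma gronwall_lt0 F C K : 0 <= C -> 0 <= K -> (forall T, lip_upto F C T) ->
  {ae mu, forall t, 0 < t -> right_dini_le F t (K * `|F t|)} ->
  F 0 < 0 -> forall T, 0 <= T -> F T < 0.
Proof.
move=> C0 K0 lF dF F0 T T0.
have Fle t : 0 <= t -> F t <= 0.
  move=> t0; apply: (gronwall_le0 C0 K0 lF) t0; last exact: ltW.
  apply: filterS dF; first exact: (ae_filter_ringOfSetsType mu).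
  by move=> x H x0 Fx; have := H x0; rewrite ger0_norm.
pose y t := - F 0 * expR (- K * t).
have y0 t : 0 < y t by rewrite mulr_gt0 ?expR_gt0// oppr_gt0.
suff : F T + y T <= 0 by have := y0 T; lra.
apply: (@dini_le0 (fun t => F t + y t) (C + - F 0 * K)) => //.
- by rewrite addr_ge0// mulr_ge0// oppr_ge0 ltW.
- move=> s t s0 st tT; rewrite opprD addrACA mulrDl.
  apply: le_trans (ler_normD _ _) _; apply: lerD; first exact: (lF T).
  rewrite /y -mulrBr normrM gtr0_norm ?oppr_gt0// -mulrA.
  by rewrite ler_wpM2l ?oppr_ge0 ?(ltW F0)//; exact: expRN_lip.
- apply: filterS dF; first exact: (ae_filter_ringOfSetsType mu).
  move=> t H t0 Fyt e e0.
  have e2 : 0 < e / 2 by rewrite divr_gt0.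
  have q : 0 < e / 2 / (y t * K ^+ 2 + 1).
    by rewrite divr_gt0// ltr_wpDl// mulr_ge0 ?exprn_ge0// ltW.
  near=> h.
  have h0 : 0 < h by near: h; exact: nbhs_right_gt.
  have Fh : F (t + h) <= F t + h * (K * `|F t| + e / 2).
    by near: h; exact: H.
  have hq : h <= e / 2 / (y t * K ^+ 2 + 1) by near: h; exact: nbhs_right_le.
  have yh : y (t + h) = y t * expR (- (K * h)).
    by rewrite /y mulrDr expRD -mulNr; ring.
  have Kh : 0 <= K * h by rewrite mulr_ge0// ltW.
  (* the inverse of 1 + x <= e^x, using (1 + x) (1 - x + x^2) = 1 + x^3 *)
  have E : expR (- (K * h)) <= 1 - K * h + (K * h) ^+ 2.
    have := expR_ge1Dx (K * h); have := expR_gt0 (- (K * h)).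
    have : expR (K * h) * expR (- (K * h)) = 1 by rewrite -expRD subrr expR0.
    set x := K * h in Kh *; move: (expR x) (expR (- x)) => E1 E2 EE E20 Ex.
    have : (1 + x) * E2 <= E1 * E2 by rewrite ler_pM2r.
    rewrite EE => H1.
    have : 0 <= x ^+ 2 * x by rewrite mulr_ge0// sqr_ge0.
    have : 0 <= x ^+ 2 by rewrite sqr_ge0.
    nra.
  have Fa : `|F t| = - F t by rewrite ler0_norm// Fle// ltW.
  have yp := y0 t.
  have hq' : h * (y t * K ^+ 2) <= e / 2.
    move: hq; rewrite ler_pdivlMr; last first.
      by rewrite ltr_wpDl// mulr_ge0 ?exprn_ge0// ltW.
    by rewrite mulrDr mulr1; lra.
  rewrite yh add0r.
  have : y t * expR (- (K * h)) <= y t * (1 - K * h + (K * h) ^+ 2) by rewrite ler_pM2l.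
  move: Fh; rewrite Fa => Fh yE.
  have : h * (h * (y t * K ^+ 2)) <= h * (e / 2) by rewrite ler_pM2l.
  have : K * h * (- F t) <= K * h * y t by rewrite ler_wpM2l//; lra.
  nra.
- by rewrite /y mulr0 expR0; lra.
Unshelve. all: by end_near. Qed.

Lemma derive_dini F t dF : is_derive t 1 F dF -> right_dini_le F t dF.
Proof.
move=> [dv vE] e e0.
have H : h^-1 *: ((F \o shift t) (h *: 1) - F t) @[h --> 0^'] --> dF.
  by rewrite -vE; exact: dv.
have /cvgrPdist_le /(_ e e0) := cvg_dnbhs_at_right H.
move=> H'; near=> h.
have h0 : 0 < h by near: h; exact: nbhs_right_gt.
have : `|dF - h^-1 *: ((F \o shift t) (h *: 1) - F t)| <= e.
  by near: h; exact: H'.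
rewrite /GRing.scale/= mulr1 ler_norml => /andP[+ _].
rewrite lerBrDr addrC -lerBrDr opprK mulrC ler_pdivrMr// => D.
rewrite (addrC t); lra.
Unshelve. all: by end_near. Qed.

(** Only a function that realizes the maximum at [t] matters; the other one stays
    below for a short time by continuity. *)
Lemma dini_max A B (t L : R) (dA dB : R) : is_derive t 1 A dA -> is_derive t 1 B dB ->
  (B t <= A t -> dA <= L) -> (A t <= B t -> dB <= L) ->
  right_dini_le (fun x => Num.max (A x) (B x)) t L.
Proof.
move=> DA DB hA hB e e0.
have K (P Q : R -> R) (dP dQ : R) : is_derive t 1 P dP -> is_derive t 1 Q dQ ->
    P t <= Q t -> (Q t <= P t -> dP <= L) ->
    \forall h \near 0^'+, P (t + h) <= Q t + h * (L + e).
  move=> DP DQ; rewrite le_eqVlt => /predU1P[PQ|PQ] hP.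
    have := derive_dini DP e0; apply: filter_app; near=> h => Ph.
    have h0 : 0 < h by near: h; exact: nbhs_right_gt.
    apply: le_trans Ph _; rewrite PQ lerD2l ler_pM2l// lerD2r hP// PQ//.
  pose m : R := `|dP + 1 - (L + e)| + 1.
  have m0 : 0 < m by rewrite ltr_wpDl.
  have qm : 0 < (Q t - P t) / m by rewrite divr_gt0//; lra.
  have := derive_dini DP (@ltr01 R); apply: filter_app; near=> h => Ph.
  apply: le_trans Ph _.
  have h0 : 0 < h by near: h; exact: nbhs_right_gt.
  have : h <= (Q t - P t) / m by near: h; exact: nbhs_right_le.
  rewrite ler_pdivlMr// => hm.
  have : h * (dP + 1 - (L + e)) <= h * m.
    by rewrite ler_pM2l// /m (le_trans (ler_norm _))// lerDl.
  lra.
have [AB|BA] := leP (A t) (B t).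
  have := K A B _ _ DA DB AB hA; apply: filter_app.
  have := K B B _ _ DB DB (lexx _) (fun _ => hB AB); apply: filter_app.
  by near=> h; move=> b1 a1; rewrite ge_max a1 b1.
have BA' := ltW BA.
have := K B A _ _ DB DA BA' hB; apply: filter_app.
have := K A A _ _ DA DA (lexx _) (fun _ => hA BA'); apply: filter_app.
by near=> h; move=> b1 a1; rewrite ge_max a1 b1.
Unshelve. all: by end_near. Qed.

End Dini.

(** * Slopes as functions of the length, and comparison *)

Section Drop.
Context {R : realType}.
Notation mu := (@lebesgue_measure R).
Implicit Types (u : R -> R) (a b x y : R).

Lemma expR_gt1D y : 0 < y -> 1 + y < expR y.
Proof. by move=> y0; apply: expR_gt1Dx; rewrite gt_eqF. Qed.

Lemma incr0_gt0 (f df : R -> R) y : (forall x, is_derive x 1 f (df x)) ->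
  (forall x, 0 < x -> 0 < df x) -> f 0 = 0 -> 0 < y -> 0 < f y.
Proof.
move=> D d0 f0 y0; have [x xy E] := MVT y0 (fun x _ => D x)
  (continuous_subspaceT (is_derive_cont D)).
have -> : f y = df x * y by move: E; rewrite f0 !subr0.
by rewrite mulr_gt0// d0// (itvP xy).
Qed.

(** After clearing denominators, y (e^y + 1) - 2 (e^y - 1) vanishes at 0 and has
    the positive derivative 1 + y e^y - e^y. *)
Lemma xcoth_sub1_gt0 y : 0 < y -> 0 < xcoth_sub1 y.
Proof.
move=> y0; have E1 : 1 < expR y by rewrite expR_gt1.
have H : 0 < y * (expR y + 1) - 2 * (expR y - 1).
  apply: (@incr0_gt0 (fun y => y * (expR y + 1) - 2 * (expR y - 1))
    (fun y => 1 + y * expR y - expR y)) => //.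
  - move=> x.
    have D0 := is_derive_cst (1 : R) x 1.
    have D1 := is_deriveM (is_derive_id x (1 : R)) (is_deriveD (is_derive_expR x) D0).
    have D2 := @is_deriveZ R R R _ 2 x 1 _ (is_deriveB (is_derive_expR x) D0).
    apply: is_derive_eq (is_deriveB D1 D2) _.
    by rewrite /GRing.scale/= !fctE; ring.
  - move=> x x0; have p := expR_gt0 x.
    have : 1 + - x < expR (- x) by apply: expR_gt1Dx; rewrite oppr_eq0 gt_eqF.
    rewrite -(ltr_pM2l p) -expRD subrr expR0; lra.
  - by rewrite expR0; ring.
rewrite /xcoth_sub1 subr_gt0 mulrA ltr_pdivlMr ?subr_gt0//; lra.
Qed.

(** The derivative has the sign of e^(2 y) - 1 - 2 y e^y, which vanishes at 0 and
    has itself the positive derivative 2 e^y (e^y - 1 - y). *)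
Lemma xcoth_sub1_lt y1 y2 : 0 < y1 -> y1 < y2 -> xcoth_sub1 y1 < xcoth_sub1 y2.
Proof.
move=> y10 y12.
pose dg x := (expR x - 1) ^- 2 * 2^-1 * (expR x ^+ 2 - 1 - 2 * x * expR x).
have D x : 0 < x -> is_derive x 1 xcoth_sub1 (dg x).
  move=> x0; have En : expR x - 1 != 0 by rewrite gt_eqF// subr_gt0 expR_gt1.
  have D1 := is_deriveD (is_derive_expR x) (is_derive_cst (1 : R) x 1).
  have D2 := is_deriveB (is_derive_expR x) (is_derive_cst (1 : R) x 1).
  have D3 := @is_deriveV R (expR - cst 1) x _ 1 En D2.
  have D4 := is_deriveM D1 D3.
  have D5 := @is_deriveZ R R R id 2^-1 x 1 _ (is_derive_id x 1).
  have D6 := is_deriveB (is_deriveM D5 D4) (is_derive_cst (1 : R) x 1).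
  rewrite (_ : xcoth_sub1 = fun z =>
    (2^-1 * z) * ((expR z + 1) * (expR z - 1)^-1) - 1); last first.
    by apply/funext => z; rewrite /xcoth_sub1; congr (_ * _ - _); rewrite mulrC.
  apply: is_derive_eq D6 _.
  change (2^-1 * x * ((expR x + 1) * (- ((expR x - 1) ^+ 2)^-1 * (expR x - 0)) +
    (expR x - 1)^-1 * (expR x + 0)) + (expR x + 1) * (expR x - 1)^-1 * (2^-1 * 1) - 0 = dg x).
  by rewrite /dg; field.
have cg : {within `[y1, y2], continuous xcoth_sub1}.
  apply: derivable_within_continuous => x; rewrite in_itv/= => /andP[y1x _].
  by have [] := D x (lt_le_trans y10 y1x).
have Dxy x : x \in `]y1, y2[ -> is_derive x 1 xcoth_sub1 (dg x).
  by move=> xy; apply: D; apply: lt_trans y10 _; rewrite (itvP xy).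
have [x xy E] := MVT y12 Dxy cg.
rewrite -subr_gt0 E mulr_gt0 ?subr_gt0//.
have x0 : 0 < x by apply: lt_trans y10 _; rewrite (itvP xy).
rewrite /dg mulr_gt0//.
  by rewrite mulr_gt0 ?invr_gt0// exprn_gt0// subr_gt0 expR_gt1.
apply: (@incr0_gt0 (fun x => expR x ^+ 2 - 1 - 2 * x * expR x)
  (fun x => 2 * expR x * (expR x - 1 - x))) => //.
- move=> z.
  have D1 := is_deriveM (is_derive_expR z) (is_derive_expR z).
  have D2 := is_deriveM (@is_deriveZ R R R id 2 z 1 _ (is_derive_id z 1)) (is_derive_expR z).
  have D3 := is_deriveB (is_deriveB D1 (is_derive_cst (1 : R) z 1)) D2.
  rewrite (_ : (fun x => _) = expR * expR - cst 1 - (2 \*: id) * expR); last first.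
    by apply/funext => w; rewrite !fctE expr2.
  apply: is_derive_eq D3 _.
  change (expR z * expR z + expR z * expR z - 0 -
    (2 * z * expR z + expR z * (2 * 1)) = 2 * expR z * (expR z - 1 - z)).
  by ring.
- move=> z z0; rewrite mulr_gt0//; first by rewrite mulr_gt0// expR_gt0.
  by have := expR_gt1D z0; lra.
- by rewrite expR0; ring.
Qed.

Lemma xcoth_sub1_le y1 y2 : 0 < y1 -> y1 <= y2 -> xcoth_sub1 y1 <= xcoth_sub1 y2.
Proof.
by move=> y10; rewrite le_eqVlt => /predU1P[->//|/(xcoth_sub1_lt y10)/ltW].
Qed.

Lemma is_derive_cvg (U : R -> R) x (l : R) : is_derive x 1 U l ->
  h^-1 * (U (x + h) - U x) @[h --> 0^'] --> l.
Proof.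
move=> [dv vE].
have H : h^-1 *: ((U \o shift x) (h *: 1) - U x) @[h --> 0^'] --> l.
  by rewrite -vE; exact: dv.
apply: cvg_trans H; apply: near_eq_cvg; near=> h.
by rewrite /GRing.scale/= mulr1 (addrC x).
Unshelve. all: by end_near. Qed.

Lemma right_deriv_of_eq (U u : R -> R) a b (l : R) : a < b -> is_derive a 1 U l ->
  {in `[a, b], U =1 u} -> is_right_deriv u a l.
Proof.
move=> ab D Uu; have := cvg_dnbhs_at_right (is_derive_cvg D).
apply: cvg_trans; apply: near_eq_cvg; near=> h.
rewrite !Uu//; rewrite in_itv/=.
  by rewrite lexx ltW.
rewrite lerDl -lerBrDl; apply/andP; split.
  by near: h; exact: nbhs_right_ge.
by near: h; apply: nbhs_right_le; rewrite subr_gt0.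
Unshelve. all: by end_near. Qed.

Lemma left_deriv_of_eq (U u : R -> R) a b (l : R) : a < b -> is_derive b 1 U l ->
  {in `[a, b], U =1 u} -> is_left_deriv u b l.
Proof.
move=> ab D Uu; have := cvg_dnbhs_at_left (is_derive_cvg D).
apply: cvg_trans; apply: near_eq_cvg; near=> h.
rewrite !Uu//; rewrite in_itv/=.
  by rewrite lexx ltW.
rewrite gerDl -lerBlDl; apply/andP; split.
  by near: h; apply: nbhs_left_ge; rewrite subr_lt0.
by near: h; exact: nbhs_left_le.
Unshelve. all: by end_near. Qed.

(** What is retained of a drop of rescaled length [y] with slopes [p] and [q] at its
    left and right ends; [N] stands for c V0 and [sg] for s / c. *)
Record drop_slopes (N sg y p q : R) : Prop := DropSlopes {
  ds_y : 0 < y;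
  ds_p : 0 <= p;
  ds_sum : p + q = - 2 * sg * xcoth_sub1 y;
  ds_diff : (p - q) * xcoth_sub1 y = N }.

Lemma argmin_slopes (V0 kappa alpha : R) u a b :
  let c := kappa * cos alpha in let s := kappa * sin alpha in
  0 < V0 -> 0 < c ->
  [set x | 0 < u x] = `]a, b[%classic -> is_argmin V0 kappa alpha a b u ->
  exists p q, [/\ is_right_deriv u a p, is_left_deriv u b q &
    drop_slopes (c * V0) (s / c) (Num.sqrt c * (b - a)) p q].
Proof.
move=> c s V00 c0 upos umin; have [[[Hu cu uout _] u0 uV] _] := umin.
have ab : a < b.
  rewrite ltNge; apply/negP => ba; move: V00; rewrite -uV.
  by rewrite set_itv_ge ?Rintegral_set0 ?ltxx// bnd_simp -leNgt.
have [lam [U [U1 [U2 [dU dU1 cU2 Uu U2E]]]]] := argmin_ode ab upos umin.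
have ua : u a = 0 by apply: uout; rewrite in_itv/= ltxx.
have ub : u b = 0 by apply: uout; rewrite in_itv/= ltxx andbF.
have uV' : \int[mu]_(x in `[a, b]) u x = V0.
  have iab : mu.-integrable `[a, b] (EFin \o u).
    apply: continuous_compact_integrable; first exact: segment_compact.
    exact: continuous_subspaceT.
  rewrite -uV -Rintegral_itv_bndo_bndc; last first.
    by apply: integrableS iab => //; exact: subset_itv_co_cc.
  rewrite -Rintegral_itv_obnd_cbnd//.
  by apply: integrableS iab => //; exact: subset_itv_oo_cc.
have [E1 E2] := ode_slopes c0 ab dU dU1 cU2 Uu U2E ua ub cu uV'.
have rp := right_deriv_of_eq ab (dU a) Uu.
exists (U1 a), (U1 b); split => //.
  exact: left_deriv_of_eq ab (dU b) Uu.
split=> //.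
  by rewrite mulr_gt0 ?sqrtr_gt0// subr_gt0.
apply: (cvgr_to_ge rp); near=> h.
rewrite ua subr0 mulr_ge0// invr_ge0.
by near: h; exact: nbhs_right_ge.
Unshelve. all: by end_near. Qed.

Section SlopeComparison.
Variables (N sg y1 y2 p1 q1 p2 q2 : R).
Hypotheses (N0 : 0 < N) (sg0 : 0 < sg).
Hypotheses (D1 : drop_slopes N sg y1 p1 q1) (D2 : drop_slopes N sg y2 p2 q2).

Lemma drop_slopes_lt0 : q1 < 0.
Proof.
case: D1 => y0 p0 S E; have g := xcoth_sub1_gt0 y0.
have d : 0 < p1 - q1 by rewrite -(pmulr_lgt0 _ g) E.
have : 0 < sg * xcoth_sub1 y1 by rewrite mulr_gt0.
lra.
Qed.

(** With d = p - q, so that d G = N, and 2 p = d - 2 sg G >= 0, the decrease of d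
    when G increases is at least 2 sg times the increase of G; hence
    - 2 q = d + 2 sg G decreases too. *)
Lemma drop_slopes_le : y1 <= y2 -> p2 <= p1 /\ q1 <= q2.
Proof.
case: D1 D2 => y10 p10 S1 E1 [y20 p20 S2 E2] y12.
have g1 := xcoth_sub1_gt0 y10; have g2 := xcoth_sub1_gt0 y20.
have g12 := xcoth_sub1_le y10 y12.
move: (xcoth_sub1 y1) (xcoth_sub1 y2) S1 S2 E1 E2 g1 g2 g12 => G1 G2 S1 S2 E1 E2 g1 g2 g12.
set d1 := p1 - q1 in E1; set d2 := p2 - q2 in E2.
have d10 : 0 < d1 by rewrite -(pmulr_lgt0 _ g1) E1.
have d20 : 0 < d2 by rewrite -(pmulr_lgt0 _ g2) E2.
have K : G2 * (d1 - d2) = d1 * (G2 - G1).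
  by rewrite mulrBr [G2 * d2]mulrC E2 -E1; ring.
have d12 : d2 <= d1.
  have : 0 <= d1 * (G2 - G1).
    by apply: mulr_ge0; [exact: ltW|rewrite subr_ge0].
  by rewrite -K (pmulr_rge0 _ g2) subr_ge0.
have p1E : 2 * p1 = d1 - 2 * sg * G1 by rewrite /d1; lra.
have p2E : 2 * p2 = d2 - 2 * sg * G2 by rewrite /d2; lra.
have q1E : 2 * q1 = - d1 - 2 * sg * G1 by rewrite /d1; lra.
have q2E : 2 * q2 = - d2 - 2 * sg * G2 by rewrite /d2; lra.
have sG : sg * G1 <= sg * G2 by rewrite ler_pM2l.
split; first lra.
suff : 2 * sg * (G2 - G1) <= d1 - d2 by lra.
rewrite -(ler_pM2l g2) K.
have -> : G2 * (2 * sg * (G2 - G1)) = (2 * sg * G2) * (G2 - G1) by ring.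
apply: ler_wpM2r; first by rewrite subr_ge0.
lra.
Qed.

(** If p1 = 0 then N = 2 sg G1^2, whereas p2 >= 0 gives N >= 2 sg G2^2. *)
Lemma drop_slopes_max : p1 = 0 -> y2 <= y1.
Proof.
case: D1 D2 => y10 p10 S1 E1 [y20 p20 S2 E2] p1E; rewrite leNgt; apply/negP => y12.
have g1 := xcoth_sub1_gt0 y10; have g2 := xcoth_sub1_gt0 y20.
have g12 := xcoth_sub1_lt y10 y12.
move: (xcoth_sub1 y1) (xcoth_sub1 y2) S1 S2 E1 E2 g1 g2 g12 => G1 G2 S1 S2 E1 E2 g1 g2 g12.
have e1 : p1 - q1 = 2 * sg * G1 by lra.
have e2 : 2 * sg * G2 <= p2 - q2 by lra.
have : 2 * sg * G2 * G2 <= (p2 - q2) * G2 by rewrite ler_pM2r.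
rewrite E2 -E1 e1.
have s2 : 0 < 2 * sg by rewrite mulr_gt0.
rewrite -!mulrA !ler_pM2l//; nra.
Qed.

End SlopeComparison.

Lemma lip_uptoP (f : R -> R) : [lipschitz f t | t in `[0, +oo[%classic] ->
  exists2 C, 0 <= C & forall T, lip_upto f C T.
Proof.
move=> [M [Mr HM]]; exists (`|M| + 1); first by rewrite addr_ge0.
move=> T s t s0 st tT.
have MM : M < `|M| + 1 by rewrite (le_lt_trans (ler_norm M))// ltrDl.
have := HM _ MM (t, s); rewrite /= => H.
rewrite -[X in _ * X]ger0_norm ?subr_ge0//; apply: H.
by split; rewrite /= in_itv/= andbT// (le_trans s0).
Qed.

Lemma lip_uptoB (f g : R -> R) C1 C2 T : lip_upto f C1 T -> lip_upto g C2 T ->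
  lip_upto (fun t => f t - g t) (C1 + C2) T.
Proof.
move=> H1 H2 s t s0 st tT.
have -> : f t - g t - (f s - g s) = (f t - f s) - (g t - g s) by ring.
rewrite mulrDl; apply: le_trans (ler_normB _ _) _.
by apply: lerD; [exact: H1|exact: H2].
Qed.

Lemma lip_upto_max (f g : R -> R) C1 C2 T : 0 <= C1 -> 0 <= C2 ->
  lip_upto f C1 T -> lip_upto g C2 T -> lip_upto (fun t => Num.max (f t) (g t)) (C1 + C2) T.
Proof.
move=> C10 C20 H1 H2 s t s0 st tT.
have := H1 s t s0 st tT; have := H2 s t s0 st tT.
have d : 0 <= t - s by rewrite subr_ge0.
have k1 : 0 <= C1 * (t - s) by rewrite mulr_ge0.
have k2 : 0 <= C2 * (t - s) by rewrite mulr_ge0.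
rewrite mulrDl !ler_norml.
by case: (leP (f t) (g t)); case: (leP (f s) (g s)); lra.
Qed.

Lemma is_derive_right_max (f : R -> R) t (l : R) : 0 <= t ->
  (forall s, 0 <= s -> f s <= f t) -> is_derive t 1 f l -> l <= 0.
Proof.
move=> t0 fmax D; have H := cvg_dnbhs_at_right (is_derive_cvg D).
apply: (cvgr_to_le H); near=> h.
have h0 : 0 < h by near: h; exact: nbhs_right_gt.
apply: mulr_ge0_le0; first by rewrite invr_ge0 ltW.
by rewrite subr_le0 fmax// addr_ge0// ltW.
Unshelve. all: by end_near. Qed.

Lemma is_derive_left_max (f : R -> R) t (l : R) : 0 < t ->
  (forall s, 0 <= s -> f s <= f t) -> is_derive t 1 f l -> 0 <= l.
Proof.
move=> t0 fmax D; have H := cvg_dnbhs_at_left (is_derive_cvg D).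
apply: (cvgr_to_ge H); near=> h.
have h0 : h < 0 by near: h; exact: nbhs_left_lt.
apply: mulr_le0; first by rewrite invr_le0 ltW.
rewrite subr_le0 fmax//.
rewrite -lerBlDl sub0r.
by near: h; apply: nbhs_left_ge; rewrite oppr_lt0.
Unshelve. all: by end_near. Qed.

Lemma lipschitzP (f : R -> R) : lipschitz f ->
  exists2 K, 0 <= K & forall x y, `|f x - f y| <= K * `|x - y|.
Proof.
move=> [M [Mr HM]]; exists (`|M| + 1); first by rewrite addr_ge0.
have MM : M < `|M| + 1 by rewrite (le_lt_trans (ler_norm M))// ltrDl.
by move=> x y; have := HM _ MM (x, y); apply.
Qed.

Lemma is_right_deriv_unique (f : R -> R) x (l1 l2 : R) :
  is_right_deriv f x l1 -> is_right_deriv f x l2 -> l1 = l2.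
Proof. by move=> h1 h2; exact: (cvg_unique (@Rhausdorff R) h1 h2). Qed.

Lemma is_left_deriv_unique (f : R -> R) x (l1 l2 : R) :
  is_left_deriv f x l1 -> is_left_deriv f x l2 -> l1 = l2.
Proof. by move=> h1 h2; exact: (cvg_unique (@Rhausdorff R) h1 h2). Qed.

(** The two complementarity conditions once it is known that p >= 0 and q < 0:
    the right end always moves by an equation, the left end only if p > 0. *)
Definition slope_law (beta a b : R -> R) (p q t : R) : Prop :=
  [/\ derivable a t 1, derivable b t 1,
      beta (a t) - 2^-1 * p ^+ 2 <= derive1 a t,
      0 < p -> derive1 a t = beta (a t) - 2^-1 * p ^+ 2 &
      derive1 b t = 2^-1 * q ^+ 2 - beta (b t)].

Lemma solution_slope_law (V0 kappa alpha : R) (beta u0 : R -> R)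
    (u : R -> R -> R) (a b : R -> R) :
  let c := kappa * cos alpha in let s := kappa * sin alpha in
  0 < V0 -> 0 < c -> 0 < s ->
  sliding_drop_solution V0 kappa alpha beta u0 u a b ->
  exists p q : R -> R,
    (forall t, 0 <= t ->
       drop_slopes (c * V0) (s / c) (Num.sqrt c * (b t - a t)) (p t) (q t)) /\
    {ae mu, forall t, 0 <= t -> slope_law beta a b (p t) (q t) t}.
Proof.
move=> c s V00 c0 s0 sol.
have ex t : exists pq : R * R, 0 <= t -> [/\ is_right_deriv (u^~ t) (a t) pq.1,
    is_left_deriv (u^~ t) (b t) pq.2 &
    drop_slopes (c * V0) (s / c) (Num.sqrt c * (b t - a t)) pq.1 pq.2].
  have [t0|t0] := leP 0 t; last by exists (0, 0).
  have [p [q H]] := argmin_slopes V00 c0 (sds_support sol t0) (sds_argmin sol t0).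
  by exists (p, q).
have [pq H] := choice ex.
exists (fun t => (pq t).1), (fun t => (pq t).2); split.
  by move=> t /H[].
have := sds_speed_a sol; apply: filterS2 (sds_speed_b sol).
  exact: (ae_filter_ringOfSetsType mu).
move=> t hb ha t0; have [da [p rp pE]] := ha t0; have [db [q lq qE]] := hb t0.
have [rp' lq' D] := H t t0.
rewrite (is_right_deriv_unique rp rp') in pE; rewrite (is_left_deriv_unique lq lq') in qE.
move: (pq t).1 (pq t).2 pE qE D => {rp rp' lq lq'}p {}q pE qE D.
have q0 : q < 0 by exact: drop_slopes_lt0 (mulr_gt0 c0 V00) (divr_gt0 s0 c0) D.
have [_ p0 _ _] := D.
rewrite ger0_norm// in pE; rewrite ltr0_norm// sqrrN in qE.
split => //.
- have : Num.min (a^`()%classic t + 2^-1 * p ^+ 2 - beta (a t)) p <=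
    a^`()%classic t + 2^-1 * p ^+ 2 - beta (a t) by rewrite ge_min lexx.
  by rewrite pE; lra.
- move=> pp; move: pE; rewrite minEle; case: ifP => _; lra.
- move: qE; rewrite minEle; case: ifP => _; lra.
Qed.

(** The quasi-monotonicity of the system of endpoints: the order of the lengths is
    read off from which difference realizes the maximum, and the order of the
    slopes follows. *)
Lemma endpoints_dini (N sg w K : R) (beta a1 b1 a2 b2 : R -> R)
    (p1 q1 p2 q2 : R -> R) t :
  0 < N -> 0 < sg -> 0 < w -> 0 < t ->
  (forall x y, `|beta x - beta y| <= K * `|x - y|) ->
  (forall s, 0 <= s -> drop_slopes N sg (w * (b1 s - a1 s)) (p1 s) (q1 s)) ->
  (forall s, 0 <= s -> drop_slopes N sg (w * (b2 s - a2 s)) (p2 s) (q2 s)) ->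
  slope_law beta a1 b1 (p1 t) (q1 t) t -> slope_law beta a2 b2 (p2 t) (q2 t) t ->
  right_dini_le (fun s => Num.max (a1 s - a2 s) (b1 s - b2 s)) t
    (K * `|Num.max (a1 t - a2 t) (b1 t - b2 t)|).
Proof.
move=> N0 sg0 w0 t0 betaK D1 D2 [da1 db1 a1ge a1E b1E] [da2 db2 a2ge a2E b2E].
have t0' := ltW t0.
have Dd (f : R -> R) : derivable f t 1 -> is_derive t 1 f (derive1 f t).
  by move=> df; rewrite derive1E; exact: derivableP.
have Da1 := Dd _ da1.
have Db1 := Dd _ db1.
have Da2 := Dd _ da2.
have Db2 := Dd _ db2.
have q10 := drop_slopes_lt0 N0 sg0 (D1 t t0').
have q20 := drop_slopes_lt0 N0 sg0 (D2 t t0').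
have p10 := ds_p (D1 t t0'); have p20 := ds_p (D2 t t0').
have bE x y : beta x - beta y <= K * `|x - y|.
  exact: le_trans (ler_norm _) (betaK x y).
have dle y1 y2 : `|y2| <= `|y1| -> 2^-1 * y2 ^+ 2 <= 2^-1 * y1 ^+ 2 :> R.
  move=> yy; rewrite ler_pM2l ?invr_gt0//.
  by rewrite -[y1 ^+ 2]real_normK ?num_real// -[y2 ^+ 2]real_normK ?num_real// lerXn2r ?nnegrE.
apply: (dini_max (is_deriveB Da1 Da2) (is_deriveB Db1 Db2)) => AB.
  have {}AB : b1 t - b2 t <= a1 t - a2 t := AB.
  rewrite max_l//.
  have y12 : w * (b1 t - a1 t) <= w * (b2 t - a2 t) by rewrite ler_pM2l//; lra.
  have [p21 q12] := drop_slopes_le N0 sg0 (D1 t t0') (D2 t t0') y12.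
  have [p1p|p1n] := ltP 0 (p1 t).
    have : 2^-1 * p2 t ^+ 2 <= 2^-1 * p1 t ^+ 2 by apply: dle; rewrite !ger0_norm.
    have := bE (a1 t) (a2 t); rewrite a1E//; lra.
  (* both drops have the maximal length: the left end of the first one is not
     given by an equation, but both lengths are maximal in time at t *)
  have p1z : p1 t = 0 by apply/eqP; rewrite eq_le p1n p10.
  have p2z : p2 t = 0 by apply/eqP; rewrite eq_le p20 andbT -p1z.
  have y21 := drop_slopes_max sg0 (D1 t t0') (D2 t t0') p1z.
  have [_ q21] := drop_slopes_le N0 sg0 (D2 t t0') (D1 t t0') y21.
  have qq : q1 t = q2 t by apply/eqP; rewrite eq_le q12 q21.
  have ABE : a1 t - a2 t = b1 t - b2 t.
    by move: y12 y21; rewrite !ler_pM2l//; lra.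
  have L1 : 0 <= derive1 b1 t - derive1 a1 t.
    apply: (is_derive_left_max t0 _ (is_deriveB Db1 Da1)) => s s0.
    by have := drop_slopes_max sg0 (D1 t t0') (D1 s s0) p1z; rewrite ler_pM2l.
  have L2 : derive1 b2 t - derive1 a2 t <= 0.
    apply: (is_derive_right_max t0' _ (is_deriveB Db2 Da2)) => s s0.
    by have := drop_slopes_max sg0 (D2 t t0') (D2 s s0) p2z; rewrite ler_pM2l.
  have := bE (b2 t) (b1 t); rewrite distrC -ABE.
  move: b1E b2E; rewrite qq; lra.
have {}AB : a1 t - a2 t <= b1 t - b2 t := AB.
rewrite max_r//.
have y21 : w * (b2 t - a2 t) <= w * (b1 t - a1 t) by rewrite ler_pM2l//; lra.
have [_ q21] := drop_slopes_le N0 sg0 (D2 t t0') (D1 t t0') y21.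
have : 2^-1 * q1 t ^+ 2 <= 2^-1 * q2 t ^+ 2.
  by apply: dle; rewrite !ltr0_norm// lerN2.
have := bE (b2 t) (b1 t); rewrite distrC b1E b2E; lra.
Qed.

Lemma comparison (V0 kappa alpha : R) (beta u01 u02 : R -> R)
    (u1 u2 : R -> R -> R) (a1 b1 a2 b2 : R -> R) :
  0 < V0 -> 0 < kappa * cos alpha -> 0 < kappa * sin alpha -> lipschitz beta ->
  sliding_drop_solution V0 kappa alpha beta u01 u1 a1 b1 ->
  sliding_drop_solution V0 kappa alpha beta u02 u2 a2 b2 ->
  let M t := Num.max (a1 t - a2 t) (b1 t - b2 t) in
  (M 0 <= 0 -> forall t, 0 <= t -> M t <= 0) /\
  (M 0 < 0 -> forall t, 0 <= t -> M t < 0).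
Proof.
move=> V00 c0 s0 betalip sol1 sol2 M.
have [K K0 betaK] := lipschitzP betalip.
have [Ca1 Ca10 la1] := lip_uptoP (sds_lipschitz_a sol1).
have [Cb1 Cb10 lb1] := lip_uptoP (sds_lipschitz_b sol1).
have [Ca2 Ca20 la2] := lip_uptoP (sds_lipschitz_a sol2).
have [Cb2 Cb20 lb2] := lip_uptoP (sds_lipschitz_b sol2).
have lM T : lip_upto M (Ca1 + Ca2 + (Cb1 + Cb2)) T.
  by apply: lip_upto_max; rewrite ?addr_ge0//; exact: lip_uptoB.
have C0 : 0 <= Ca1 + Ca2 + (Cb1 + Cb2) by rewrite !addr_ge0.
have [p1 [q1 [D1 law1]]] := solution_slope_law V00 c0 s0 sol1.
have [p2 [q2 [D2 law2]]] := solution_slope_law V00 c0 s0 sol2.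
have dM : {ae mu, forall t, 0 < t -> right_dini_le M t (K * `|M t|)}.
  apply: filterS2 law1 law2; first exact: (ae_filter_ringOfSetsType mu).
  move=> t h1 h2 t0.
  apply: (endpoints_dini _ _ _ t0 betaK D1 D2 (h1 (ltW t0)) (h2 (ltW t0))).
  - exact: mulr_gt0.
  - exact: divr_gt0.
  - by rewrite sqrtr_gt0.
split=> M0 t t0; last exact: (gronwall_lt0 C0 K0 lM dM).
apply: (gronwall_le0 C0 K0 lM) t0 => //.
apply: filterS dM; first exact: (ae_filter_ringOfSetsType mu).
by move=> x H x0 Mx; have := H x0; rewrite ger0_norm.
Qed.

End Drop.

Theorem proposition2p3 (R : realType) (V0 kappa alpha : R)
    (V0_gt0 : 0 < V0) (kappa_gt0 : 0 < kappa)
    (alpha_gt0 : 0 < alpha) (alpha_lt_pi2 : alpha < pi / 2)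
    (beta : R -> R) (beta_lip : lipschitz beta)
    (u01 u02 : R -> R) (u1 u2 : R -> R -> R) (a1 b1 a2 b2 : R -> R)
    (sol1 : sliding_drop_solution V0 kappa alpha beta u01 u1 a1 b1)
    (sol2 : sliding_drop_solution V0 kappa alpha beta u02 u2 a2 b2)
    (le_a0 : a1 0 <= a2 0) (le_b0 : b1 0 <= b2 0) :
  (forall t : R, 0 < t -> a1 t <= a2 t /\ b1 t <= b2 t) /\
  (a1 0 < a2 0 -> b1 0 < b2 0 ->
   forall t : R, 0 < t -> a1 t < a2 t /\ b1 t < b2 t).
Proof.
have pi0 := pi_gt0 R.
have c0 : 0 < kappa * cos alpha.
  by rewrite mulr_gt0// cos_gt0_pihalf//; apply/andP; split; lra.
have s0 : 0 < kappa * sin alpha.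
  by rewrite mulr_gt0// sin_gt0_pi//; lra.
have [cle clt] := comparison V0_gt0 c0 s0 beta_lip sol1 sol2.
split=> [t /ltW t0|a0 b0 t /ltW t0].
  have := cle _ t t0; rewrite !ge_max !subr_le0 le_a0 le_b0 => /(_ isT).
  by move=> /andP.
have := clt _ t t0; rewrite !gt_max !subr_lt0 a0 b0 => /(_ isT).
by move=> /andP.
Qed.
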